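(* Let $m\ge 2$ be a fixed integer and let $\alpha\ge 1$. Let $f(x_1,\ldots,x_m)=c_0\cdot x_1^{\alpha-1}\cdots x_m^{\alpha-1}$ on $\overline{\nabla}_{m-1}$, where $1/c_0=\int_{\nabla_{m-1}}x_1^{\alpha-1}\cdots x_m^{\alpha-1}\,dx_1\cdots dx_{m-1}$. For each $n$ let $\kappa=(k_1,\ldots,k_m)\in\mathcal{P}_n(m)$ be chosen with probability $$P_n(\kappa)=c_{n,m}\cdot f\Big(\frac{k_1}{n},\ldots,\frac{k_m}{n}\Big),\qquad c_{n,m}=\Big(\sum_{(k_1,\ldots,k_m)\in\mathcal{P}_n(m)}f\Big(\frac{k_1}{n},\ldots,\frac{k_m}{n}\Big)\Big)^{-1}.$$ Then, as $n\to\infty$, $$\Big(\frac{k_1}{n},\ldots,\frac{k_m}{n}\Big)\to(X_{(1)},\ldots,X_{(m)})$$ in distribution, where $(X_{(1)},\ldots,X_{(m)})$ is the decreasing order statistics of $(X_1,\ldots,X_m)\sim\mathrm{Dir}(\alpha)$.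
   Context: For integers $n,m\ge 1$, $\mathcal{P}_n(m)$ denotes the set of partitions of $n$ with at most $m$ parts; its elements are written as $\kappa=(k_1,\ldots,k_m)$ with integers $k_1\ge k_2\ge\cdots\ge k_m\ge 0$ and $\sum_{i=1}^m k_i=n$ (shorter partitions are padded with zeros). The ordered $(m-1)$-dimensional simplex is $$\nabla_{m-1}=\Big\{(y_1,\ldots,y_m)\in[0,1]^m;\ y_1>y_2>\cdots>y_{m-1}>y_m\ \text{ and }\ y_m=1-\sum_{i=1}^{m-1}y_i\Big\},$$ and $\overline{\nabla}_{m-1}$ is its closure. Integrals over it are with respect to Lebesgue measure in the first $m-1$ coordinates (the last coordinate being $1$ minus their sum). $(X_1,\ldots,X_m)\sim\mathrm{Dir}(\alpha)$ (symmetric Dirichlet distribution with parameter $\alpha>0$) means that $(X_1,\ldots,X_m)$ has density $$\frac{\Gamma(m\alpha)}{\Gamma(\alpha)^m}x_1^{\alpha-1}\cdots x_m^{\alpha-1}$$ with respect to $dx_1\cdots dx_{m-1}$ on the simplex $W_{m-1}=\{(x_1,\ldots,x_m)\in[0,1]^m;\ \sum_{i=1}^m x_i=1\}$, and zero elsewhere. The measure $P_n$ is considered for those $n$ for which the normalizing sum is positive, which is the case for all sufficiently large $n$. *)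

(* Defs.v *)
From HB Require Import structures.
From mathcomp Require Import all_boot all_order all_algebra.
From mathcomp Require Import all_classical all_reals all_analysis.
Set Implicit Arguments.
Unset Strict Implicit.
Unset Printing Implicit Defensive.
Import Order.TTheory GRing.Theory Num.Theory.
Import numFieldNormedType.Exports.
Local Open Scope classical_set_scope.
Local Open Scope ring_scope.

(* Lebesgue measure on R^n, as the iterated product of the one on R;
   lebesgue_tuple_box below gives its value on boxes. *)
Fixpoint lebesgue_tuple (R : realType) (n : nat) : set (n.-tuple R) -> \bar R :=
  match n with
  | 0 => \d_([tuple] : 0.-tuple R)
  | n'.+1 => pushforward (lebesgue_measure \x @lebesgue_tuple R n')%E
               (fun p : R * n'.-tuple R => [tuple of p.1 :: p.2])
  end.

Section lebesgue_tuple_measure.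
Variable R : realType.

Let consp n (p : R * n.-tuple R) : n.+1.-tuple R := [tuple of p.1 :: p.2].

Let mconsp n : measurable_fun [set: R * n.-tuple R] (@consp n).
Proof. exact: measurable_cons. Qed.

Let sigma_finite_consp n
    (mu : {sigma_finite_measure set (n.-tuple R) -> \bar R}) :
  sigma_finite setT (pushforward (@lebesgue_measure R \x mu)%E (@consp n)).
Proof.
have /sigma_finiteP[F [TF ndF Foo]] := sigma_finiteT (@lebesgue_measure R).
have /sigma_finiteP[G [TG ndG Goo]] := sigma_finiteT mu.
pose tl (x : n.+1.-tuple R) := [tuple of behead x].
exists (fun k => (@thead n R) @^-1` F k `&` tl @^-1` G k).
  apply/seteqP; split=> [x _|//].
  have : setT (thead x) by []. rewrite TF => -[i _ Fi].
  have : setT (tl x) by []. rewrite TG => -[j _ Gj].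
  exists (maxn i j) => //; split.
  - by have /subsetPset := ndF _ _ (leq_maxl i j); exact.
  - by have /subsetPset := ndG _ _ (leq_maxr i j); exact.
move=> k; have [mF Fk] := Foo k; have [mG Gk] := Goo k; split.
  apply: measurableI; rewrite -[X in measurable X]setTI.
  - exact: (measurable_tnth ord0).
  - exact: (@measurable_behead _ _ n).
rewrite /pushforward (_ : _ @^-1` _ = F k `*` G k); last first.
  apply/seteqP; split=> -[a b] /= [Fa Gb]; split=> //=.
  - by move: Gb; rewrite (_ : tl _ = b)//; exact: val_inj.
  - by rewrite (_ : tl _ = b)//; exact: val_inj.
by rewrite product_measure1E// lte_mul_pinfty// ge0_fin_numE.
Qed.

Let lebesgue_tuple_sfm n :
  {mu : {sigma_finite_measure set (n.-tuple R) -> \bar R} |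
    lebesgue_tuple (n := n) = mu}.
Proof.
elim: n => [|n [mu IH]].
  by exists \d_([tuple] : 0.-tuple R).
pose c : {measure set (n.+1.-tuple R) -> \bar R} :=
  measure_function_pushforward__canonical__measure_function_Measure
    (@lebesgue_measure R \x mu)%E (@mconsp n).
pose b := Measure_isSigmaFinite.Build _ _ _ c (@sigma_finite_consp n mu).
pose m : {sigma_finite_measure set (n.+1.-tuple R) -> \bar R} :=
  HB.pack (Measure.sort c) (Measure.class c) b.
by exists m => /=; rewrite IH.
Qed.

Let lebesgue_tuple0 n : @lebesgue_tuple R n set0 = 0%E.
Proof. by have [mu ->] := lebesgue_tuple_sfm n; exact: measure0. Qed.

Let lebesgue_tuple_ge0 n A : (0 <= @lebesgue_tuple R n A)%E.
Proof. by have [mu ->] := lebesgue_tuple_sfm n; exact: measure_ge0. Qed.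

Let lebesgue_tuple_sigma_additive n :
  semi_sigma_additive (@lebesgue_tuple R n).
Proof.
have [mu ->] := lebesgue_tuple_sfm n; exact: measure_semi_sigma_additive.
Qed.

HB.instance Definition _ n := isMeasure.Build _ _ _ (@lebesgue_tuple R n)
  (lebesgue_tuple0 n) (@lebesgue_tuple_ge0 n)
  (@lebesgue_tuple_sigma_additive n).

Let lebesgue_tuple_sigma_finite n : sigma_finite setT (@lebesgue_tuple R n).
Proof. by have [mu ->] := lebesgue_tuple_sfm n; exact: sigma_finiteT. Qed.

HB.instance Definition _ n := Measure_isSigmaFinite.Build _ _ _
  (@lebesgue_tuple R n) (lebesgue_tuple_sigma_finite n).

Lemma lebesgue_tuple_box n (A : 'I_n -> set R) :
  (forall i, measurable (A i)) ->
  lebesgue_tuple [set x : n.-tuple R | forall i, A i (tnth x i)] =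
  (\prod_(i < n) @lebesgue_measure R (A i))%E.
Proof.
elim: n A => [|n IH] A mA.
  rewrite big_ord0 /= diracE mem_set//= => -[]//.
rewrite big_ord_recl -IH//=.
pose B := [set x : n.-tuple R | forall i, A (lift ord0 i) (tnth x i)].
have mB : measurable B.
  rewrite (_ : B =
      \bigcap_(i in [set: 'I_n]) (@tnth n R ^~ i) @^-1` A (lift ord0 i)).
    apply: fin_bigcap_measurable => // i _; rewrite -[X in measurable X]setTI.
    exact: measurable_tnth.
  by apply/seteqP; split=> x /= Ax i => [_|]; exact: Ax.
rewrite -/B; apply: etrans (product_measure1E (@lebesgue_measure R)
  (@lebesgue_tuple R n) (mA ord0) mB).
rewrite /pushforward; congr ((_ \x _)%E _).
apply/seteqP; split=> [[a b] /= Aab|[a b] /= [Aa Ab] i].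
  split=> [|i]; first exact: (Aab ord0).
  by have := Aab (lift ord0 i); rewrite tnthS.
by case: (unliftP ord0 i) => [j ->|->]; rewrite ?tnthS.
Qed.

End lebesgue_tuple_measure.

Section simplex.
Variables (R : realType) (m : nat).

(* The point of the hyperplane x_1 + ... + x_m = 1 with the given first m - 1
   coordinates (meant for 0 < m). *)
Definition complete (t : m.-1.-tuple R) : m.-tuple R :=
  [tuple if (i < m.-1)%N then t`_i else 1 - \sum_(j < m.-1) tnth t j | i < m].

Definition ordered_simplex : set (m.-tuple R) :=
  [set y | [/\ forall i, 0 <= tnth y i <= 1,
               forall i j : 'I_m, (i < j)%N -> tnth y j < tnth y i
             & \sum_(i < m) tnth y i = 1]].

Definition simplex : set (m.-tuple R) :=
  [set x | (forall i, 0 <= tnth x i <= 1) /\ \sum_(i < m) tnth x i = 1].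

(* 0 `^ 0 = 1, so this is the constant 1 for a = 1. *)
Definition monomial (a : R) (x : m.-tuple R) : R :=
  \prod_(i < m) tnth x i `^ (a - 1).

Definition c0 (a : R) : R :=
  (fine (\int[@lebesgue_tuple R m.-1]_(t in complete @^-1` ordered_simplex)
           (monomial a (complete t))%:E))^-1.

(* Only evaluated on the closure of ordered_simplex. *)
Definition simplex_density (a : R) (x : m.-tuple R) : R := c0 a * monomial a x.

End simplex.

Section partitions.
Variables (R : realType) (m : nat).

Definition partitions (n : nat) : set (m.-tuple nat) :=
  [set k : m.-tuple nat | sorted geq k /\ (\sum_(i < m) tnth k i)%N = n].

(* In particular the sums over partitions n below are genuine finite sums. *)
Lemma finite_partitions n : finite_set (partitions n).
Proof.
apply: (@sub_finite_set _ _ ((fun k : m.-tuple 'I_n.+1 =>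
    [tuple of map val k] : m.-tuple nat) @` setT)); last first.
  exact/finite_image/finite_finset.
move=> k [_ kn]; exists [tuple of map inord k] => //.
apply: eq_from_tnth => i; rewrite !tnth_map /= inordK// ltnS -kn.
by rewrite (bigD1 i) //= leq_addr.
Qed.

Definition rescale (n : nat) (k : m.-tuple nat) : m.-tuple R :=
  [tuple (tnth k i)%:R / n%:R | i < m].

Definition norm_sum (a : R) (n : nat) : R :=
  \sum_(k \in partitions n) simplex_density a (rescale n k).

Definition Pn (a : R) (n : nat) (k : m.-tuple nat) : R :=
  (norm_sum a n)^-1 * simplex_density a (rescale n k).

End partitions.

Definition gamma_fun (R : realType) (a : R) : R :=
  fine (\int[lebesgue_measure]_(x in `]0%R, +oo[) (x `^ (a - 1) * expR (- x))%:E).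

Definition dirichlet_pdf (R : realType) (m : nat) (a : R) (x : m.-tuple R) : R :=
  if x \in @simplex R m
  then gamma_fun (m%:R * a) / gamma_fun a ^+ m * monomial a x else 0.

Definition dirichlet d (T : measurableType d) (R : realType) (m : nat)
    (P : probability T R) (X : {RV P >-> m.-tuple R}) (a : R) :=
  forall A : set (m.-tuple R), measurable A ->
    distribution P X A =
    (\int[@lebesgue_tuple R m.-1]_(t in @complete R m @^-1` A)
       (dirichlet_pdf a (complete t))%:E)%E.

Arguments dirichlet {d T R m} P X a.

Definition order_stat (R : realType) (m : nat) (x : m.-tuple R) : m.-tuple R :=
  [tuple of sort >=%R x].

(* The topology of R^m is that of 'rV[R]_m. *)
Definition cvg_in_distribution (R : realType) (m : nat)
    (d : nat -> measure_display) (T : forall n, measurableType (d n))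
    (Q : forall n, probability (T n) R) (Y : forall n, T n -> m.-tuple R)
    (d' : measure_display) (T' : measurableType d') (P : probability T' R)
    (Z : T' -> m.-tuple R) :=
  forall g : 'rV[R]_m -> R, continuous g ->
    (exists M : R, forall v, `|g v| <= M) ->
    ('E_(Q n)[fun w => g (\row_i tnth (Y n w) i)] @[n --> \oo] -->
     'E_P[fun w => g (\row_i tnth (Z w) i)])%E.

(* Main.v *)
Require Import Defs.
From mathcomp Require Import all_boot all_order all_algebra.
From mathcomp Require Import all_classical all_reals all_analysis.
From mathcomp Require Import measurable_realfun ring lra zify.

(* Both limits are compared with the same integrals over the simplex. For a
   continuous F on the simplex, the sum of F (c / n) over all compositions c of n
   into m parts, divided by n^(m-1), tends to the integral of F in the first
   m - 1 coordinates: it is the integral of a step function converging pointwise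
   everywhere, and dominated convergence applies. For a symmetric F, the sum over
   compositions is m! times the sum over partitions, up to the O(n^(m-2))
   compositions with two equal parts. So E[g (K_n / n)] tends to the ratio of the
   integrals of (g o sort) x monomial and of the monomial; c_0 cancels once it is
   known to be positive. The same ratio is E[g (sort X)], the Gamma factor being
   determined by the total mass 1. Working with all compositions makes the
   permutation invariance combinatorial: the invariance of Lebesgue measure under
   permutations involving the dependent last coordinate is never needed. *)

Set Implicit Arguments.
Unset Strict Implicit.
Unset Printing Implicit Defensive.
Import Order.TTheory GRing.Theory Num.Theory.
Import numFieldNormedType.Exports.
Local Open Scope ring_scope.

(** * Compositions and partitions *)

Section compositions.
Variables (m n : nat).
Implicit Types c k : m.-tuple 'I_n.+1.

Definition compositions : {set m.-tuple 'I_n.+1} :=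
  [set c : m.-tuple 'I_n.+1 | (\sum_(i <- c) i == n)%N].

Let geo : rel 'I_n.+1 := fun i j => (j <= i)%N.

Definition sorted_compositions : {set m.-tuple 'I_n.+1} :=
  [set c in compositions | sorted geo c].

Let geo_total : total geo.
Proof. by move=> i j; exact: leq_total. Qed.

Let geo_trans : transitive geo.
Proof. by move=> i j k ij ki; exact: leq_trans ki ij. Qed.

Let geo_anti : antisymmetric geo.
Proof. by move=> i j /andP[ij ji]; apply/val_inj/anti_leq/andP. Qed.

Lemma card_perm_eq_tuple (T : finType) (k : m.-tuple T) : uniq k ->
  #|[set c : m.-tuple T | perm_eq c k]| = m`!.
Proof.
move=> Uk; rewrite cardE -(size_map (val : m.-tuple T -> seq T)).
rewrite -[in RHS](size_tuple k) -size_permutations //; apply/perm_size.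
apply: uniq_perm; first by rewrite map_inj_uniq ?enum_uniq //; exact: val_inj.
  exact: permutations_uniq.
move=> s; rewrite mem_permutations; apply/mapP/idP => [[c]|sk].
  by rewrite mem_enum inE => ck ->.
have ss : size s == m by rewrite (perm_size sk) size_tuple.
by exists (Tuple ss) => //; rewrite mem_enum inE.
Qed.

Lemma perm_compositions c k : perm_eq c k ->
  (c \in compositions) = (k \in compositions).
Proof. by move=> ck; rewrite !inE (perm_big _ ck). Qed.

Lemma sum_uniq_compositions (R : zmodType) (F : m.-tuple 'I_n.+1 -> R) :
  (forall c k, perm_eq c k -> F c = F k) ->
  \sum_(c in compositions | uniq c) F c =
  (\sum_(c in sorted_compositions | uniq c) F c) *+ m`!.
Proof.
move=> Fsym; pose srt c : m.-tuple 'I_n.+1 := [tuple of sort geo c].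
have srtP c : perm_eq (srt c) c by rewrite perm_sort.
rewrite (partition_big srt (fun k => (k \in sorted_compositions) && uniq k)).
  rewrite -sumrMnl; apply: eq_bigr => k /andP[]; rewrite inE => /andP[kC ks] Uk.
  rewrite -(card_perm_eq_tuple Uk) -sumr_const; apply: eq_big => [c|c].
    rewrite inE; apply/idP/idP => [/andP[_ /eqP<-]|ck].
      by rewrite perm_sym.
    rewrite (perm_compositions ck) kC (perm_uniq ck) Uk /=; apply/eqP/val_inj.
    apply: (sorted_eq geo_trans geo_anti) => //; first exact: sort_sorted.
    exact: perm_trans (srtP c) ck.
  by case/andP=> _ /eqP<-; apply: Fsym; rewrite perm_sym.
move=> c /andP[cC Uc]; rewrite (perm_uniq (srtP c)) Uc andbT inE.
by rewrite (perm_compositions (srtP c)) cC sort_sorted.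
Qed.

(** Union bound over the pairs of positions that may carry equal entries. For two distinct
    positions, such a composition is determined by its other [m - 2] entries, because the total then
    fixes the common value. *)
Lemma card_tied_compositions :
  (#|[set c in compositions | ~~ uniq c]| <= m ^ 2 * n.+1 ^ (m - 2))%N.
Proof.
pose tied (ij : 'I_m * 'I_m) :=
  [set c in compositions | (ij.1 != ij.2) && (tnth c ij.1 == tnth c ij.2)].
have sub : [set c in compositions | ~~ uniq c] \subset (\bigcup_ij tied ij)%SET.
  apply/fintype.subsetP => c; rewrite inE => /andP[cC Uc].
  have : ~~ injectiveb (tnth c).
    by apply: contra Uc; rewrite /injectiveb /dinjectiveb map_tnth_enum.
  case/injectivePn => i [j ij cij]; apply/finset.bigcupP; exists (i, j) => //.
  by move: cC; rewrite !inE /= => ->; rewrite ij cij eqxx.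
apply: leq_trans (subset_leq_card sub) _.
have card_tied ij : (#|tied ij| <= n.+1 ^ (m - 2))%N.
  case: ij => i j; have [<-|ij] := eqVneq i j.
    by rewrite (_ : tied _ = finset.set0) ?cards0 //;
      apply/finset.setP => c; rewrite !inE eqxx /= andbF.
  pose D := [pred l : 'I_m | l \notin [set i; j]].
  pose r c : {ffun {l | D l} -> 'I_n.+1} := [ffun l => tnth c (val l)].
  have cD : #|{: {l | D l}}| = (m - 2)%N.
    rewrite card_sig -[RHS](_ : #|~: [set i; j]| = _).
      by apply: eq_card => l; rewrite !inE.
    by rewrite cardsCs finset.setCK cards2 ij card_ord.
  rewrite -[X in (X ^ _)%N](card_ord n.+1) -cD -card_ffun.
  apply: (@leq_card_in _ _ r) => c k; rewrite !inE /=.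
  rewrite !big_tuple => /and3P[/eqP cn _ /eqP cij] /and3P[/eqP kn _ /eqP kij] /ffunP rck.
  have off l : l != i -> l != j -> tnth c l = tnth k l.
    move=> li lj; have Dl : D l by rewrite !inE negb_or li.
    by have := rck (Sub l Dl); rewrite !ffunE.
  (* All entries off [i] and [j] agree and the totals are equal, so twice the tied value agrees as
     well; doubling is injective. *)
  have cki : tnth c i = tnth k i.
    apply/val_inj/double_inj; apply/eqP; rewrite -!addnn.
    have split2 (b : m.-tuple 'I_n.+1) : (\sum_(l < m) tnth b l = tnth b i + tnth b j +
        \sum_(l < m | (l != i) && (l != j)) tnth b l)%N.
      by rewrite (bigD1 i) // (bigD1 j) 1?eq_sym //= addnA.
    have := etrans cn (esym kn); rewrite !split2.
    rewrite (eq_bigr (fun l => tnth k l : nat)) => [/eqP|l /andP[li lj]].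
      by rewrite eqn_add2r -cij -kij.
    by rewrite off.
  apply: eq_from_tnth => l; have [->//|li] := eqVneq l i.
  have [->|lj] := eqVneq l j; last exact: off.
  by rewrite -cij -kij.
apply: (@leq_trans (\sum_ij #|tied ij|)).
  elim/big_rec2: _ => [|ij s A _ As]; first by rewrite cards0.
  by rewrite cardsU (leq_trans (leq_subr _ _)) // leq_add2l.
rewrite -[X in (X ^ 2 * _)%N](card_ord m) -mulnn -card_prod -sum_nat_const.
exact: leq_sum.
Qed.

(** The untied terms cancel exactly, by [sum_uniq_compositions]. What remains are tied terms,
    counted [m]![times in the first sum and once in the second, whence the factor]m[!.+1]. *)
Lemma le_dist_sum_compositions (R : numDomainType) (B : R)
    (F : m.-tuple 'I_n.+1 -> R) : 0 <= B ->
  (forall c, c \in compositions -> `|F c| <= B) ->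
  (forall c k, perm_eq c k -> F c = F k) ->
  `|(\sum_(c in sorted_compositions) F c) *+ m`! -
    \sum_(c in compositions) F c| <=
  B *+ (m`!.+1 * (m ^ 2 * n.+1 ^ (m - 2))).
Proof.
move=> B0 FB Fsym.
rewrite (bigID (fun c => uniq (val c)) (mem sorted_compositions)) /=.
rewrite (bigID (fun c => uniq (val c)) (mem compositions)) /=.
rewrite sum_uniq_compositions // mulrnDl opprD addrACA subrr add0r.
have tie (A : {set m.-tuple 'I_n.+1}) : {subset A <= compositions} ->
    `|\sum_(c in A | ~~ uniq c) F c| <= B *+ (m ^ 2 * n.+1 ^ (m - 2)).
  move=> AC; apply: le_trans (ler_norm_sum _ _ _) _.
  apply: (@le_trans _ _ (\sum_(c in A | ~~ uniq c) B)).
    by apply: ler_sum => c /andP[/AC/FB].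
  rewrite sumr_const; apply: ler_wpMn2l => //.
  apply: leq_trans card_tied_compositions; apply: subset_leq_card.
  by apply/fintype.subsetP => c; rewrite inE => /andP[/AC -> ->].
apply: le_trans (ler_normB _ _) _; rewrite mulSn mulrnDr addrC.
rewrite lerD ?tie // (mulnC m`!) mulrnA normrMn ler_wMn2r // tie //.
by move=> c; rewrite inE => /andP[].
Qed.

End compositions.

Local Open Scope classical_set_scope.
Local Open Scope ring_scope.

(** * Order statistics *)

Section order_statistics.
Variable R : realType.
Implicit Types (s : seq R) (c e : R).

(** In a decreasing list the entries above [c] form an initial segment. This reduces comparisons of
    order statistics to counting, which ignores the order of the entries. *)
Lemma nth_sorted_gt c s i : sorted >=%R s -> (i < size s)%N ->
  (c < nth 0 s i) = (i < count (> c) s)%N.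
Proof.
elim: s i => [//|x s IH] i /= xs; have [cx|xc] := ltP c x.
  case: i => [|i] /=; first by rewrite cx.
  by rewrite add1n !ltnS; apply: IH; exact: path_sorted xs.
have ge_trans : transitive (>=%R : rel R) by move=> y z t /= yz ty; exact: le_trans ty yz.
have /allP sx := order_path_min ge_trans xs.
rewrite (@eq_in_count _ _ pred0) ?count_pred0 => [|y /sx yx]; last first.
  by rewrite ltNge (le_trans yx xc).
move=> ilts; apply/negbTE; rewrite -leNgt.
case: i ilts => [//|i] ilts /=.
by apply: le_trans xc; apply: sx; rewrite mem_nth.
Qed.

(** Otherwise more than [i] entries of [x] exceed the [i]-th order statistic of [y] plus [e]
    (counting from 0), so more than [i] entries of [y] exceed that statistic itself, which is
    absurd. Used in both directions, this makes sorting 1-Lipschitz for the sup norm. *)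
Lemma order_stat_le m (x y : m.-tuple R) e :
  (forall i, tnth x i <= tnth y i + e) ->
  forall i, tnth (order_stat x) i <= tnth (order_stat y) i + e.
Proof.
move=> xye i; rewrite !(tnth_nth 0) /=.
have ge_total : total (>=%R : rel R) by move=> a b; exact: le_total.
rewrite leNgt; apply/negP; rewrite nth_sorted_gt ?sort_sorted ?size_sort ?size_tuple //.
rewrite (permP (permEl (perm_sort _ _))) => ic.
have : (i < count (> ((sort >=%R y)`_i)%R) y)%N.
  apply: leq_trans ic _; rewrite -!sum1_count !big_tuple.
  rewrite big_mkcond [leqRHS]big_mkcond; apply: leq_sum => j _.
  case: ifP => // /lt_le_trans /(_ (xye j)); rewrite ltrD2r => ->.
  by [].
rewrite -(permP (permEl (perm_sort >=%R y))).
by rewrite -nth_sorted_gt ?sort_sorted ?size_sort ?size_tuple // ltxx.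
Qed.

Lemma order_stat_perm m (x y : m.-tuple R) :
  perm_eq x y -> order_stat x = order_stat y.
Proof.
move=> xy; apply/val_inj; apply/perm_sortP => //.
- by move=> a b; exact: le_total.
- by move=> a b c /= ab ca; exact: le_trans ca ab.
- by move=> a b /=; rewrite andbC; exact: le_anti.
Qed.

(** Continuity is phrased with sequences converging coordinatewise, so that no topology on tuples is
    involved. It is relative to [A] because [monomial] is only considered up to the boundary of the
    simplex, from inside. *)
Definition seq_continuous_on m (A : set (m.-tuple R)) (F : m.-tuple R -> R) :=
  forall (u : nat -> m.-tuple R) (x : m.-tuple R), (forall n, A (u n)) -> A x ->
    (forall i, tnth (u n) i @[n --> \oo] --> tnth x i) ->
    F (u n) @[n --> \oo] --> F x.

Lemma seq_continuous_order_stat m (g : 'rV[R]_m -> R) : continuous g ->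
  seq_continuous_on setT (fun x => g (\row_i tnth (order_stat x) i)).
Proof.
move=> gc u x _ _ ux.
apply: (@cvg_comp _ _ _ (fun n => \row_i tnth (order_stat (u n)) i)) (gc _).
apply/cvg_ballP => e e0.
have : \forall n \near \oo, forall i, `|tnth x i - tnth (u n) i| <= e / 2.
  apply: filter_forall => i; move/cvgrPdist_le : (ux i); apply.
  by rewrite divr_gt0.
apply: filterS => n xu; split=> // i j; rewrite !mxE /ball /=.
(* Balls are open while [order_stat_le] gives a large inequality, hence the margin [e / 2]. *)
apply: (@le_lt_trans _ _ (e / 2)); last by rewrite ltr_pdivrMr // ltr_pMr // ltr1n.
rewrite ler_distl; apply/andP; split.
  rewrite lerBlDr; apply: order_stat_le => l.
  by have := xu l; rewrite ler_distlC => /andP[].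
apply: order_stat_le => l.
by have := xu l; rewrite ler_distl => /andP[].
Qed.

End order_statistics.

(** * Integrals of functions of a discrete variable *)

Section finitely_many_fibers.
Context d (T : measurableType d) (R : realType).
Variable mu : {measure set T -> \bar R}.

(** [D] is the disjoint union of finitely many fibers of [Z], and [phi \o Z] is constant on each.
    Measurability of the integrand is also obtained fiber by fiber, so [phi] is arbitrary. *)
Lemma integral_finite_fibers (I : choiceType) (D : set T) (Z : T -> I) (s : seq I)
    (phi : I -> R) (p : T -> R) :
  uniq s -> (forall c, measurable (D `&` Z @^-1` [set c])) ->
  (forall x, D x -> Z x \in s) -> mu.-integrable D (EFin \o p) ->
  (\int[mu]_(x in D) (phi (Z x) * p x)%:E =
   \sum_(c <- s) (phi c)%:E * \int[mu]_(x in D `&` Z @^-1` [set c]) (p x)%:E)%E.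
Proof.
move=> Us mDZ DZs ip; pose F c := D `&` Z @^-1` [set c].
have DF : D = \big[setU/set0]_(c <- s) F c.
  apply/seteqP; split=> [x Dx|x].
    by rewrite -bigcup_seq; exists (Z x); [exact: DZs|split].
  by rewrite -bigcup_seq => -[c _ []].
have FD c : F c `<=` D by move=> x [].
have mD : measurable D by rewrite DF; apply: bigsetU_measurable => c _; exact: mDZ.
have mp : measurable_fun D p by apply/measurable_EFinP; exact: measurable_int ip.
rewrite {1}DF integral_bigsetU_EFin //; last 2 first.
- by move=> c c' _ _ [x [[_ <-] [_ <-]]].
- rewrite -DF => _ Y mY; rewrite [X in measurable X](_ : _ =
      \big[setU/set0]_(c <- s) (F c `&` (fun x => (phi c * p x)%:E) @^-1` Y)).
    apply: bigsetU_measurable => c _.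
    have : measurable_fun (F c) (fun x => (phi c * p x)%:E).
      by apply/measurable_EFinP/measurable_funM => //; exact: measurable_funS mp.
    by move=> /(_ (mDZ c) _ mY).
  rewrite {1}DF; apply/seteqP; split=> [x|x]; rewrite -!bigcup_seq.
    move=> [[c sc [Dx Zc]] Yx]; exists c => //; split=> //.
    by have {1}<- : Z x = c by [].
  move=> [c sc [[Dx Zc] Yx]]; split; first by exists c.
  by have Zxc : Z x = c by []; rewrite /= Zxc.
apply: eq_bigr => c _.
transitivity (\int[mu]_(x in F c) ((phi c)%:E * (p x)%:E))%E.
  by apply: eq_integral => x /[!inE] -[_ <-].
rewrite integralZl; [by []|exact: mDZ|exact: (integrableS mD (mDZ c) (@FD c) ip)].
Qed.

End finitely_many_fibers.

(** * Rounding down to a grid *)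

Section truncation.
Variable R : realType.

Lemma truncn_scaled_bounds (x : R) n : 0 <= x ->
  0 <= x - (Num.truncn (n.+1%:R * x))%:R / n.+1%:R < n.+1%:R^-1.
Proof.
move=> x0; have n0 : 0 < n.+1%:R :> R by rewrite ltr0n.
have /truncn_itv /andP[h1 h2] : 0 <= n.+1%:R * x by rewrite mulr_ge0 // ltW.
rewrite (_ : x - _ = (n.+1%:R * x - (Num.truncn (n.+1%:R * x))%:R) / n.+1%:R).
  apply/andP; split; first by rewrite divr_ge0 ?subr_ge0 ?(ltW n0).
  by rewrite -[ltRHS]mul1r ltr_pM2r ?invr_gt0 // ltrBlDr addrC natr1.
by field; rewrite gt_eqF.
Qed.

Lemma cvg_truncn_scaled (x : R) : 0 <= x ->
  (Num.truncn (n.+1%:R * x))%:R / n.+1%:R @[n --> \oo] --> x.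
Proof.
move=> x0; apply/cvgrPdist_le => e e0.
near=> n; have /andP[h1 h2] := truncn_scaled_bounds n x0.
rewrite ger0_norm //; apply: le_trans (ltW h2) _.
near: n; apply: filterS (near_infty_natSinv_lt (PosNum e0)) => n; exact: ltW.
Unshelve. all: by end_near. Qed.

Lemma measurable_truncn : measurable_fun [set: R] (Num.truncn : R -> nat).
Proof.
move=> _ Y _; rewrite setTI [X in measurable X](_ : _ =
    \bigcup_(k in Y) Num.truncn @^-1` [set k]); last first.
  by apply/seteqP; split=> [x Yx|x [k Yk /= ->]] //; exists (Num.truncn x).
apply: bigcup_measurable => -[|k] _.
  (* [Num.truncn] sends every negative real to 0, so the fiber of 0 is unbounded below. *)
  rewrite (_ : _ @^-1` _ = `]-oo, 1[%classic); first exact: measurable_itv.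
  apply/seteqP; split=> x /=; rewrite in_itv /=; first move=> x0.
    by rewrite ltNge -truncn_gt0 x0.
  by rewrite ltNge -truncn_gt0 lt0n negbK => /eqP.
rewrite (_ : _ @^-1` _ = `[k.+1%:R, k.+2%:R[%classic); first exact: measurable_itv.
apply/seteqP; split=> x /=; rewrite in_itv /=.
  move=> xk; rewrite -truncn_eq ?xk //.
  by have := truncn_gt0 x; rewrite xk => /esym; exact: le_trans.
by move=> xk; exact: truncn_def.
Qed.

Lemma measurable_tuple_nat m (A : set (m.-tuple nat)) : measurable A.
Proof.
apply: countable_measurable; last exact: countableP.
move=> c; rewrite (_ : [set c] =
    \bigcap_(i in [set: 'I_m]) (@tnth m nat ^~ i) @^-1` [set tnth c i]).
  apply: fin_bigcap_measurable => // i _; rewrite -[X in measurable X]setTI.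
  exact: measurable_tnth.
apply/seteqP; split=> [x -> //|x xc]; apply: eq_from_tnth => i; exact: xc.
Qed.

Lemma measurable_fun_tuple_nat m d (T : measurableType d)
  (f : m.-tuple nat -> T) : measurable_fun setT f.
Proof. by move=> _ Y _; exact: measurable_tuple_nat. Qed.

End truncation.

(** [F] is the pointwise limit of its values at grid points of mesh [1 / n.+1]. These approximations
    factor through [m.-tuple nat], on which every function is measurable. *)
Lemma measurable_seq_continuous (R : realType) m (F : m.-tuple R -> R) :
  seq_continuous_on setT F -> measurable_fun setT F.
Proof.
move=> Fc.
(* Truncation rounds down only nonnegative reals. The shift by [n], undone in [N], makes the
   coordinates of any given [x] nonnegative for all large [n]. *)
pose Z n (x : m.-tuple R) : m.-tuple nat :=
  [tuple Num.truncn (n.+1%:R * (tnth x i + n%:R)) | i < m].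
pose N n (k : m.-tuple nat) : m.-tuple R :=
  [tuple (tnth k i)%:R / n.+1%:R - n%:R | i < m].
have mZ n : measurable_fun setT (Z n).
  apply/measurable_fun_tnthP => i; rewrite [X in measurable_fun _ X](_ : _ =
    Num.truncn \o (fun x : m.-tuple R => n.+1%:R * (tnth x i + n%:R))).
    apply: (measurableT_comp (@measurable_truncn R)).
    apply: measurable_funM => //; apply: measurable_funD => //.
    exact: measurable_tnth.
  by apply/funext => x /=; rewrite tnth_mktuple.
apply: (@measurable_fun_cvg _ _ _ _ (fun n => (F \o N n) \o Z n)) => [n|x _].
  by apply: measurableT_comp (mZ n); exact: measurable_fun_tuple_nat.
apply: (Fc (fun n => N n (Z n x))) => // i; rewrite /N /Z.
under eq_fun do rewrite !tnth_mktuple.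
apply/cvgrPdist_le => e e0; near=> n.
have xn : 0 <= tnth x i + n%:R.
  rewrite -lerBlDl sub0r.
  apply: le_trans (ler_norm _) _; rewrite normrN; near: n.
  exact: nbhs_infty_ger.
have /andP[h1 h2] := truncn_scaled_bounds n xn.
rewrite opprB addrA ger0_norm //.
apply: le_trans (ltW h2) _; near: n.
by apply: filterS (near_infty_natSinv_lt (PosNum e0)) => n; exact: ltW.
Unshelve. all: by end_near. Qed.

(** * Integration against a law given by a density *)

Section change_of_variables.
Context (d1 d2 d : measure_display) (T1 : measurableType d1) (T2 : measurableType d2).
Context (Y : measurableType d) (R : realType).
Variables (mu1 : {finite_measure set T1 -> \bar R}).
Variables (mu2 : {measure set T2 -> \bar R}).
Variables (X : T1 -> Y) (Z : T2 -> Y) (p : T2 -> R).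
Hypotheses (mX : measurable_fun setT X) (mZ : measurable_fun setT Z).
Hypothesis ip : mu2.-integrable setT (EFin \o p).
Hypothesis Xp : forall A, measurable A ->
  (mu1 (X @^-1` A) = \int[mu2]_(t in Z @^-1` A) (p t)%:E)%E.

(** [Xp] says that the law of [X] is the image under [Z] of the measure with density [p]. The
    identity is checked for finitely valued approximations of [G], then passed to the limit by
    dominated convergence on both sides. *)
Lemma integral_change_density (G : Y -> R) (M : R) :
  measurable_fun setT G -> (forall y, `|G y| <= M) ->
  (\int[mu1]_w (G (X w))%:E = \int[mu2]_t (G (Z t) * p t)%:E)%E.
Proof.
move=> mG GM.
have GM0 y : 0 <= G y + M by have := GM y; rewrite ler_norml => /andP[]; lra.
(* Adding [M] makes the truncated quantity nonnegative, so [phi n (N n y)] is below [G y] by at most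
   [1 / n.+1]. As [G] is bounded, [N n] takes finitely many values. *)
pose N n y := Num.truncn (n.+1%:R * (G y + M)).
pose phi n (j : nat) : R := j%:R / n.+1%:R - M.
have mN n : measurable_fun setT (N n).
  apply: (measurableT_comp (@measurable_truncn R)).
  by apply: measurable_funM => //; exact: measurable_funD.
have Nphi n y : G y + M - n.+1%:R^-1 <= phi n (N n y) + M <= G y + M.
  have := truncn_scaled_bounds n (GM0 y); rewrite -/(N n y) /phi.
  move=> /andP[h1 h2]; rewrite subrK lerBlDr -lerBlDl (ltW h2) /=.
  by rewrite -subr_ge0.
have phi_cvg y : phi n (N n y) @[n --> \oo] --> G y.
  rewrite -[X in _ --> X](addrK M); apply: cvgB; last exact: cvg_cst.
  exact: cvg_truncn_scaled.
have phiM n y : `|phi n (N n y)| <= M.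
  rewrite ler_norml; have /andP[_ h] := Nphi n y.
  have h' : 0 <= (N n y)%:R / n.+1%:R :> R by rewrite divr_ge0.
  have := GM y; rewrite ler_norml => /andP[_ ?].
  by move: h h'; rewrite /phi; set q := (N n y)%:R / _ => h h'; apply/andP; split; lra.
have Ns n y : N n y \in iota 0 (Num.truncn (n.+1%:R * (M + M))).+1.
  rewrite mem_iota /= add0n ltnS; apply: le_truncn; rewrite ler_wpM2l //.
  by rewrite lerD2r; apply: le_trans (ler_norm _) (GM y).
have mphi n : measurable_fun setT (fun y => phi n (N n y)).
  by apply: (@measurableT_comp _ _ _ _ _ _ (phi n)).
have approx n : (\int[mu1]_w (phi n (N n (X w)))%:E =
                 \int[mu2]_t (phi n (N n (Z t)) * p t)%:E)%E.
  transitivity (\int[mu1]_w (phi n (N n (X w)) * 1)%:E)%E.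
    by apply: eq_integral => w _; rewrite mulr1.
  have mF c : measurable (N n @^-1` [set c]).
    by rewrite -[X in measurable X]setTI; exact: mN.
  rewrite (@integral_finite_fibers _ _ _ mu1 _ setT (N n \o X)
    (iota 0 (Num.truncn (n.+1%:R * (M + M))).+1) (phi n) (cst 1)) ?iota_uniq //; last 3 first.
  - by move=> c; exact: (mX measurableT (mF c)).
  - by move=> w _; exact: Ns.
  - exact: finite_measure_integrable_cst.
  rewrite (@integral_finite_fibers _ _ _ mu2 _ setT (N n \o Z)
    (iota 0 (Num.truncn (n.+1%:R * (M + M))).+1) (phi n) p) ?iota_uniq //; last 2 first.
  - by move=> c; exact: (mZ measurableT (mF c)).
  - by move=> t _; exact: Ns.
  apply: eq_bigr => c _; congr (_ * _)%E; rewrite !setTI /cst integral_cst ?mul1e.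
    exact: (Xp (mF c)).
  by rewrite -[X in measurable X]setTI; exact: (mX measurableT (mF c)).
have lim1 : (\int[mu1]_w (phi n (N n (X w)))%:E)%E @[n --> \oo] -->
    (\int[mu1]_w (G (X w))%:E)%E.
  apply: (@dominated_cvg _ _ _ mu1 setT _ _ _ (fun=> M%:E)) => //.
  - by move=> n; apply/measurable_EFinP; exact: measurableT_comp (mphi n) mX.
  - by move=> w _; apply: cvg_EFin => //; [exact: nearW|exact: phi_cvg].
  - exact: finite_measure_integrable_cst.
  - by move=> n w _; rewrite lee_fin.
suff lim2 : (\int[mu1]_w (phi n (N n (X w)))%:E)%E @[n --> \oo] -->
    (\int[mu2]_t (G (Z t) * p t)%:E)%E.
  by rewrite -(cvg_lim (@ereal_hausdorff R) lim1) (cvg_lim _ lim2).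
under eq_fun do rewrite approx.
apply: (@dominated_cvg _ _ _ mu2 setT _ _ _ (fun t => M%:E * `|(p t)%:E|)%E) => //.
- move=> n; apply/measurable_EFinP; apply: measurable_funM.
    exact: measurableT_comp (mphi n) mZ.
  by apply/measurable_EFinP; exact: measurable_int ip.
- move=> t _; apply: cvg_EFin; first exact: nearW.
  by apply: cvgM; [exact: phi_cvg|exact: cvg_cst].
- by apply: integrableZl => //; exact: integrable_abse.
- by move=> n t _; rewrite /= lee_fin normrM ler_wpM2r.
Qed.

End change_of_variables.

(** * Riemann sums over the simplex *)

Lemma ord_max_or_widen m (i : 'I_m.+1) :
  i = ord_max \/ exists j, i = widen_ord (leqnSn m) j.
Proof.
case: (unliftP ord_max i) => [j ->|->]; [right|by left].
by exists j; apply/val_inj; exact: lift_max.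
Qed.

Section completed_points.
Variables (R : realType) (m : nat).
Let mu := @lebesgue_tuple R m.

Definition values n k (c : k.-tuple 'I_n.+1) : k.-tuple nat :=
  [tuple (tnth c i : nat) | i < k].

Definition truncate_point n (t : m.-tuple R) : m.-tuple nat :=
  [tuple Num.truncn (n.+1%:R * tnth t i) | i < m].

Lemma measurable_truncate_point n : measurable_fun setT (truncate_point n).
Proof.
apply/measurable_fun_tnthP => i; rewrite [X in measurable_fun _ X](_ : _ =
  Num.truncn \o (fun t : m.-tuple R => n.+1%:R * tnth t i)).
  apply: (measurableT_comp (@measurable_truncn R)).
  by apply: measurable_funM => //; exact: measurable_tnth.
by apply/funext => t /=; rewrite tnth_mktuple.
Qed.

Lemma tnth_complete_widen (t : m.-tuple R) i :
  tnth (complete (m := m.+1) t) (widen_ord (leqnSn m) i) = tnth t i.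
Proof. by rewrite tnth_mktuple /= ltn_ord (tnth_nth 0). Qed.

Lemma tnth_complete_max (t : m.-tuple R) :
  tnth (complete (m := m.+1) t) ord_max = 1 - \sum_(j < m) tnth t j.
Proof. by rewrite tnth_mktuple /= ltnn. Qed.

Lemma measurable_complete : measurable_fun setT (@complete R m.+1).
Proof.
apply/measurable_fun_tnthP => i; case: (ord_max_or_widen i) => [->|[j ->]]; last first.
  rewrite [X in measurable_fun _ X](_ : _ = (@tnth m R ^~ j)).
    exact: measurable_tnth.
  by apply/funext => t /=; rewrite tnth_complete_widen.
rewrite [X in measurable_fun _ X](_ : _ = fun t : m.-tuple R =>
    1 - \sum_(j < m) tnth t j).
  apply: measurable_funB => //; apply: measurable_sum => j.
  exact: measurable_tnth.
by apply/funext => t /=; rewrite tnth_complete_max.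
Qed.

Lemma sum_complete (t : m.-tuple R) :
  \sum_(i < m.+1) tnth (complete (m := m.+1) t) i = 1.
Proof.
rewrite big_ord_recr /= tnth_complete_max addrC -[RHS](subrK (\sum_(j < m) tnth t j)).
by congr (_ + _); apply: eq_bigr => i _; rewrite tnth_complete_widen.
Qed.

Lemma simplex_completeP (t : m.-tuple R) :
  @simplex R m.+1 (complete (m := m.+1) t) <->
  (forall i, 0 <= tnth t i) /\ \sum_(i < m) tnth t i <= 1.
Proof.
split=> [[t01 _]|[t0 st]].
  split=> [i|]; last by rewrite -subr_ge0 -tnth_complete_max; case/andP: (t01 ord_max).
  by rewrite -tnth_complete_widen; case/andP: (t01 (widen_ord (leqnSn m) i)).
have c0 i : 0 <= tnth (complete (m := m.+1) t) i.
  by case: (ord_max_or_widen i) => [->|[j ->]];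
    rewrite ?tnth_complete_max ?subr_ge0 ?tnth_complete_widen.
split=> [i|]; last exact: sum_complete.
rewrite c0 /= -(sum_complete t) (bigD1 i) //= lerDl; exact: sumr_ge0.
Qed.

Lemma measurable_simplex_complete : measurable (@complete R m.+1 @^-1` @simplex R m.+1).
Proof.
rewrite (_ : _ @^-1` _ =
  (\bigcap_(i in [set: 'I_m]) (@tnth m R ^~ i) @^-1` `[0, +oo[%classic)
  `&` (fun t : m.-tuple R => \sum_(i < m) tnth t i) @^-1` `]-oo, 1]%classic).
  apply: measurableI.
    apply: fin_bigcap_measurable => // i _; rewrite -[X in measurable X]setTI.
    exact: (measurable_tnth i measurableT (measurable_itv _)).
  have msum : measurable_fun setT (fun t : m.-tuple R => \sum_(i < m) tnth t i).
    by apply: measurable_sum => i; exact: measurable_tnth.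
  rewrite -[X in measurable X]setTI.
  exact: (msum measurableT _ (measurable_itv _)).
apply/seteqP; split=> [t /simplex_completeP [t0 t1]|t [t0 t1]].
  by split=> /= [i _|]; rewrite /= in_itv /= ?t0.
apply/simplex_completeP; split=> [i|]; last by move: t1; rewrite /= in_itv.
by have := t0 i Logic.I; rewrite /= in_itv /= andbT.
Qed.

Lemma measurable_box (a b : 'I_m -> itv_bound R) :
  measurable [set t : m.-tuple R | forall i, tnth t i \in Interval (a i) (b i)].
Proof.
rewrite (_ : [set _ | _] = \bigcap_(i in [set: 'I_m]) (@tnth m R ^~ i) @^-1`
  [set` Interval (a i) (b i)]).
  apply: fin_bigcap_measurable => // i _; rewrite -[X in measurable X]setTI.
  exact: (measurable_tnth i measurableT (measurable_itv _)).
by apply/seteqP; split=> [t tab i _|t tab i] /=; [exact: tab|exact: (tab i Logic.I)].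
Qed.

(** The booleans choose which endpoints belong to the sides, so that both half-open grid cells and
    closed cubes are covered. *)
Lemma lebesgue_cube (a : 'I_m -> R) (b0 b1 : bool) (e : R) : 0 <= e ->
  mu [set t | forall i, tnth t i \in Interval (BSide b0 (a i)) (BSide b1 (a i + e))]
  = (e ^+ m)%:E.
Proof.
move=> e0; have := @lebesgue_tuple_box R m
  (fun i => [set` Interval (BSide b0 (a i)) (BSide b1 (a i + e))]).
rewrite /mu => ->; last by move=> i; exact: measurable_itv.
rewrite -[m in RHS]card_ord -prodr_const -prodEFin; apply: eq_bigr => i _.
rewrite lebesgue_measure_itv /= lte_fin ltrDl -EFinB addrC addKr.
by case: ltgtP e0 => // <-.
Qed.

End completed_points.

Section riemann_sums.
Variables (R : realType) (m : nat).
Let mu := @lebesgue_tuple R m.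

Definition drop_last n (c : m.+1.-tuple 'I_n) : m.-tuple nat :=
  [tuple (tnth c (widen_ord (leqnSn m) i) : nat) | i < m].

(** The mesh is [1 / n.+1], which avoids division by zero. The last coordinate is negative when the
    entries of [k] add up to more than [n.+1]. *)
Definition grid_point n (k : m.-tuple nat) : m.+1.-tuple R :=
  complete (m := m.+1) [tuple (tnth k i)%:R / n.+1%:R | i < m].

Lemma sum_drop_last n (c : m.+1.-tuple 'I_n.+1) : c \in compositions m.+1 n ->
  (\sum_(i < m) tnth (drop_last c) i + tnth c ord_max = n)%N.
Proof.
rewrite inE big_tuple big_ord_recr /= => /eqP cn.
rewrite -[RHS]cn; congr (_ + _)%N; apply: eq_bigr => i _.
by rewrite tnth_mktuple.
Qed.

Lemma grid_point_drop_last n (c : m.+1.-tuple 'I_n.+2) : c \in compositions m.+1 n.+1 ->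
  grid_point n (drop_last c) = rescale R n.+1 (values c).
Proof.
move=> cn; apply: eq_from_tnth => i; rewrite [RHS]tnth_mktuple /grid_point.
case: (ord_max_or_widen i) => [->|[j ->]]; last first.
  by rewrite tnth_complete_widen !tnth_mktuple.
rewrite tnth_complete_max; under eq_bigr do rewrite tnth_mktuple.
have n0 : n.+1%:R != 0 :> R by rewrite pnatr_eq0.
rewrite -mulr_suml -[X in X - _](divff n0) -mulrBl -natr_sum -natrB; last first.
  by rewrite -[leqRHS](sum_drop_last cn) leq_addr.
by rewrite -[X in (X - _)%N](sum_drop_last cn) addKn tnth_mktuple.
Qed.

Lemma drop_last_inj n : {in compositions m.+1 n.+1 &, injective (@drop_last n.+2)}.
Proof.
move=> c c' cn cn' cc'; have : rescale R n.+1 (values c) = rescale R n.+1 (values c').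
  by rewrite -!grid_point_drop_last // cc'.
move=> /(congr1 (fun x : m.+1.-tuple R => tnth x)) e.
apply: eq_from_tnth => i; have := congr1 (fun f => f i) e; rewrite !tnth_mktuple.
have n0 : n.+1%:R != 0 :> R by rewrite pnatr_eq0.
by move/(divIf n0)/eqP; rewrite eqr_nat => /eqP/val_inj.
Qed.

Lemma drop_last_surj n (k : m.-tuple nat) : (\sum_(i < m) tnth k i <= n)%N ->
  exists2 c, c \in compositions m.+1 n & drop_last c = k.
Proof.
move=> kn; have kin i : (tnth k i <= n)%N.
  by apply: leq_trans kn; rewrite (bigD1 i) //= leq_addr.
pose c : m.+1.-tuple 'I_n.+1 :=
  [tuple of rcons [tuple inord (tnth k i) | i < m] (inord (n - \sum_(i < m) tnth k i)%N)].
have cl : tnth c ord_max = inord (n - \sum_(i < m) tnth k i)%N.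
  by rewrite (tnth_nth ord0) /= nth_rcons size_map size_enum_ord ltnn eqxx.
have cw (i : 'I_m) : tnth c (widen_ord (leqnSn m) i) = inord (tnth k i).
  rewrite (tnth_nth ord0) /= nth_rcons size_map size_enum_ord ltn_ord.
  by rewrite (nth_map i) ?size_enum_ord // nth_ord_enum.
exists c; last first.
  by apply: eq_from_tnth => i; rewrite tnth_mktuple cw inordK // ltnS.
rewrite inE big_tuple big_ord_recr /= cl inordK ?ltnS ?leq_subr //.
rewrite (eq_bigr (fun i => tnth k i)) => [|i _]; last by rewrite cw inordK // ltnS.
by rewrite subnKC.
Qed.

Let nonneg := [set t : m.-tuple R | forall i, 0 <= tnth t i].

Let mnonneg : measurable nonneg.
Proof.
have := @measurable_box R m (fun=> BLeft 0) (fun=> +oo%O).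
by congr measurable; apply/seteqP; split=> t t0 i; have := t0 i; rewrite /= in_itv /= andbT.
Qed.

(** The fibers of the truncation are half-open cubes of side [1 / n.+1]. Intersecting with [nonneg]
    matters where [k] has a zero entry, since negative reals also truncate to 0. *)
Let cell n (k : m.-tuple nat) : nonneg `&` truncate_point n @^-1` [set k] =
  [set t | forall i, tnth t i \in
    `[(tnth k i)%:R / n.+1%:R, (tnth k i)%:R / n.+1%:R + n.+1%:R^-1[].
Proof.
have n0 : 0 < n.+1%:R :> R by rewrite ltr0n.
have itvE (x : R) j : (x \in `[j%:R / n.+1%:R, j%:R / n.+1%:R + n.+1%:R^-1[) =
    (j%:R <= n.+1%:R * x < j.+1%:R).
  rewrite in_itv /= ler_pdivrMr // -[X in _ + X]mul1r -mulrDl ltr_pdivlMr //.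
  by rewrite natr1 mulrC.
apply/seteqP; split=> [t [t0 <-] i|t tk].
  by rewrite itvE tnth_mktuple; apply: truncn_itv; rewrite mulr_ge0 // ltW.
split=> [i|]; last first.
  by apply: eq_from_tnth => i; rewrite tnth_mktuple; apply: truncn_def; rewrite -itvE.
have := tk i; rewrite itvE => /andP[h _].
by rewrite -(pmulr_rge0 _ n0); apply: le_trans h.
Qed.

Let mcell n (k : m.-tuple nat) : mu (nonneg `&` truncate_point n @^-1` [set k]) =
  (n.+1%:R ^- m)%:E.
Proof. by rewrite cell /mu lebesgue_cube ?invr_ge0 // exprVn. Qed.

Let fits n := [set k : m.-tuple nat | (\sum_(i < m) tnth k i <= n.+1)%N].

Lemma grid_point_simplex n k : fits n k -> @simplex R m.+1 (grid_point n k).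
Proof.
move=> kn; apply/simplex_completeP; split=> [i|]; first by rewrite tnth_mktuple divr_ge0.
under eq_bigr do rewrite tnth_mktuple.
by rewrite -mulr_suml -natr_sum ler_pdivrMr ?ltr0n // mul1r ler_nat.
Qed.

Let cvg_grid_point t : nonneg t -> forall i,
  tnth (grid_point n (truncate_point n t)) i @[n --> \oo] -->
  tnth (complete (m := m.+1) t) i.
Proof.
move=> t0 i; rewrite /grid_point.
have ct j : tnth [tuple (tnth (truncate_point n t) i)%:R / n.+1%:R : R | i < m] j
    @[n --> \oo] --> tnth t j.
  by under eq_fun do rewrite !tnth_mktuple; exact: (cvg_truncn_scaled (t0 j)).
case: (ord_max_or_widen i) => [->|[j ->]]; last first.
  by under eq_fun do rewrite tnth_complete_widen; rewrite tnth_complete_widen; exact: ct.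
under eq_fun do rewrite tnth_complete_max.
rewrite tnth_complete_max; apply: cvgB; first exact: cvg_cst.
by apply: cvg_big => [|j _]; [exact: add_continuous|exact: ct].
Qed.

Let fits_truncate n t : nonneg t -> \sum_(i < m) tnth t i <= 1 ->
  fits n (truncate_point n t).
Proof.
move=> t0 t1; rewrite /fits /= -(ler_nat R) natr_sum.
apply: (@le_trans _ _ (n.+1%:R * \sum_(i < m) tnth t i)).
  rewrite mulr_sumr; apply: ler_sum => i _; rewrite tnth_mktuple.
  by rewrite truncn_le mulr_ge0.
by rewrite -[leRHS]mulr1 ler_wpM2l.
Qed.

(** A common domain for all [n]. Cells whose corner lies in the simplex may stick out of it, but
    their coordinates stay below [n.+2 / n.+1], hence below 2. *)
Let cube := [set t : m.-tuple R | forall i, tnth t i \in `[0, 0 + 2]].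

Let cubeE n : cube `&` truncate_point n @^-1` fits n =
  nonneg `&` truncate_point n @^-1` fits n.
Proof.
have n0 : 0 < n.+1%:R :> R by rewrite ltr0n.
apply/seteqP; split=> t [tc tn]; split=> // i.
  by have := tc i; rewrite in_itv => /andP[].
rewrite in_itv /= tc add0r -(ler_pM2l n0); apply: ltW.
apply: lt_le_trans (truncnS_gt _) _; rewrite -natrM ler_nat.
suff : (Num.truncn (n.+1%:R * tnth t i) <= n.+1)%N.
  by move=> tn1; rewrite muln2 -addnn -addn1 leq_add.
by apply: leq_trans tn; rewrite (bigD1 i) //= tnth_mktuple leq_addr.
Qed.

(** The sum is the integral over [cube] of the step function [f_ n], equal on each cell that fits to
    [F] at the grid point of its corner, and 0 elsewhere; a cell has volume [n.+1%:R ^- m].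
    Dominated convergence applies with the bound [M]. *)
Lemma cvg_riemann_sum (F : m.+1.-tuple R -> R) (M : R) :
  measurable_fun setT F -> (forall x, @simplex R m.+1 x -> `|F x| <= M) ->
  seq_continuous_on (@simplex R m.+1) F ->
  ((\sum_(c in compositions m.+1 n.+1) F (rescale R n.+1 (values c))) /
    n.+1%:R ^+ m)%:E @[n --> \oo] -->
  (\int[mu]_(t in @complete R m.+1 @^-1` @simplex R m.+1)
    (F (complete (m := m.+1) t))%:E)%E.
Proof.
move=> mF FM Fc.
have M0 : 0 <= M.
  (* The vertex (0, ..., 0, 1) shows that the simplex is nonempty, so [M] bounds some absolute
     value. *)
  apply: le_trans (FM (grid_point 0 [tuple 0%N | i < m]) _) => //.
  apply: grid_point_simplex; rewrite /fits /=.
  by rewrite big1 // => i _; rewrite tnth_mktuple.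
pose f_ n (t : m.-tuple R) := if (\sum_(i < m) tnth (truncate_point n t) i <= n.+1)%N
  then F (grid_point n (truncate_point n t)) else 0.
pose f := (fun t => (F (complete (m := m.+1) t))%:E) \_
  (@complete R m.+1 @^-1` @simplex R m.+1).
have mcube : measurable cube by exact: measurable_box.
have mucube : (mu cube < +oo)%E.
  by rewrite /cube /mu (@lebesgue_cube R m (fun=> 0) true false 2) ?ltry.
have mfit n : measurable (truncate_point n @^-1` fits n : set (m.-tuple R)).
  rewrite -[X in measurable X]setTI.
  exact: (@measurable_truncate_point R m n measurableT _ (measurable_tuple_nat _)).
have sumE n : ((\sum_(c in compositions m.+1 n.+1) F (rescale R n.+1 (values c))) /
    n.+1%:R ^+ m)%:E = (\int[mu]_(t in cube) (f_ n t)%:E)%E.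
  transitivity (\int[mu]_(t in cube `&` truncate_point n @^-1` fits n)
      (F (grid_point n (truncate_point n t)) * 1)%:E)%E; last first.
    rewrite integral_mkcondr; apply: eq_integral => t _; rewrite patchE /f_ mulr1.
    case: ifP => [|/negP]; rewrite inE /fits /=; first by move=> ->.
    by move=> /negP/negbTE ->.
  rewrite cubeE (@integral_finite_fibers _ _ _ mu _ _ (truncate_point n)
    [seq drop_last c | c <- enum (compositions m.+1 n.+1)]
    (fun k => F (grid_point n k)) (cst 1)).
  - rewrite big_map big_enum mulr_suml -sumEFin; apply: eq_bigr => c cn.
    rewrite EFinM grid_point_drop_last //; congr (_ * _)%E.
    rewrite (_ : _ `&` _ `&` _ =
      nonneg `&` truncate_point n @^-1` [set drop_last c]); last first.
      apply/seteqP; split=> [t [[t0 _] tc] //|t [t0 tc]]; split=> //; split=> //.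
      have {}tc : truncate_point n t = drop_last c := tc.
      by rewrite /= /fits /= tc -[leqRHS](sum_drop_last cn) leq_addr.
    rewrite /cst integral_cst ?mul1e; first exact/esym/mcell.
    apply: measurableI; first exact: mnonneg.
    rewrite -[X in measurable X]setTI.
    exact: (@measurable_truncate_point R m n measurableT _ (measurable_tuple_nat _)).
  - rewrite map_inj_in_uniq ?enum_uniq // => c c'; rewrite !mem_enum.
    exact: drop_last_inj.
  - move=> k; apply: measurableI; first by apply: measurableI; [exact: mnonneg|exact: mfit].
    rewrite -[X in measurable X]setTI.
    exact: (@measurable_truncate_point R m n measurableT _ (measurable_tuple_nat _)).
  - move=> t [_ tn]; have [c cn <-] := drop_last_surj tn.
    by apply: map_f; rewrite mem_enum.
  - apply: (@integrableS _ _ _ _ cube).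
    + exact: mcube.
    + by rewrite -cubeE; exact: measurableI.
    + by rewrite -cubeE; exact: subIsetl.
    + apply: measurable_bounded_integrable => //.
      by exists 1; split=> // x /ltW x1 t _; rewrite /= normr1.
under eq_fun do rewrite sumE.
rewrite (_ : (\int[mu]_(t in _) _)%E = (\int[mu]_(t in cube) f t)%E); last first.
  rewrite /f -integral_mkcondr; congr (integral _ _ _); apply/esym.
  apply/setIidPr => t /simplex_completeP [t0 t1] i; rewrite in_itv /= t0 add0r.
  apply: (@le_trans _ _ 1); last by rewrite ler1n.
  by apply: le_trans t1; rewrite (bigD1 i) //= lerDl; apply: sumr_ge0.
apply: (@dominated_cvg _ _ _ mu _ mcube _ _ (fun=> M%:E)) => //.
- move=> n; apply/measurable_EFinP.
  apply: (@measurable_funS _ _ _ _ setT) => //.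
  have mg := measurable_fun_tuple_nat (fun k : m.-tuple nat =>
    if (\sum_(i < m) tnth k i <= n.+1)%N then F (grid_point n k) else 0).
  exact: (measurableT_comp mg (@measurable_truncate_point R m n)).
- move=> t tc; have t0 : nonneg t by move=> i; have := tc i; rewrite in_itv /= => /andP[].
  rewrite /f patchE; case: ifPn => [|ts].
    rewrite inE /= => ts; have [_ t1] := (simplex_completeP t).1 ts.
    apply: cvg_EFin; first exact: nearW.
    under eq_fun => n do rewrite /= /f_ (fits_truncate n t0 t1).
    apply: Fc => // [n|]; last exact: cvg_grid_point.
    exact/grid_point_simplex/fits_truncate.
  (* Off the simplex the coordinate sum strictly exceeds 1. The sum of the rounded coordinates then
     eventually does too, and [f_ n t] is 0 from there on. *)
  have t1 : 1 < \sum_(i < m) tnth t i.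
    rewrite ltNge; apply: contra ts => t1; rewrite inE /=.
    exact/simplex_completeP.
  apply: cvg_near_cst.
  have cs : \sum_(i < m) (tnth (truncate_point n t) i)%:R / n.+1%:R @[n --> \oo] -->
      \sum_(i < m) tnth t i.
    apply: cvg_big; first exact: add_continuous.
    move=> i _; under eq_fun do rewrite tnth_mktuple.
    exact: (cvg_truncn_scaled (t0 i)).
  have : \forall n \near \oo, 1 < \sum_(i < m) (tnth (truncate_point n t) i)%:R / n.+1%:R :> R.
    exact: cvgr_gt cs _ t1.
  apply: filterS => n; rewrite -mulr_suml -natr_sum ltr_pdivlMr ?ltr0n // mul1r ltr_nat.
  by move=> tn; rewrite /f_ leqNgt tn.
- apply: (measurable_bounded_integrable (f := cst M)) => //.
  by exists `|M|; split=> // x /ltW x1 t _.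
- move=> n t tc; rewrite lee_fin /f_; case: ifP => [tn|_]; last by rewrite normr0.
  by apply: FM; exact: grid_point_simplex.
Qed.

End riemann_sums.

(** * The Dirichlet monomial and its normalization *)

Section monomials.
Variables (R : realType).

(** For [p = 0] the power is constantly 1, even at 0. For positive [p] and [x] it is differentiable
    at [x]; at [x = 0] it may fail to be, and there [u n <= e]^ p^-1[gives]u n [^ p <= e]
    directly. *)
Lemma cvg_powR (u : nat -> R) (x p : R) : 0 <= p -> (forall n, 0 <= u n) -> 0 <= x ->
  u n @[n --> \oo] --> x -> u n `^ p @[n --> \oo] --> x `^ p.
Proof.
move=> p0 u0 x0 ux; have [->|pn0] := eqVneq p 0.
  by under eq_fun do rewrite powRr0; rewrite powRr0; exact: cvg_cst.
have {pn0} p0 : 0 < p by rewrite lt_neqAle eq_sym pn0.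
move: x0; rewrite le_eqVlt => /orP[/eqP x0|x0]; last first.
  have px : {for x, continuous (@powR R ^~ p)}.
    apply: differentiable_continuous; apply/derivable1_diffP.
    by apply: derivable_powR; rewrite in_itv /= x0.
  exact: cvg_comp ux px.
rewrite -x0 powR0 ?gt_eqF //; rewrite -x0 in ux.
apply/cvgr0Pnorm_le => e e0.
have /cvgr0Pnorm_le /(_ (e `^ p^-1)) := ux; move/(_ (powR_gt0 _ e0)).
apply: filterS => n; rewrite !ger0_norm ?powR_ge0 // => une.
rewrite -[leRHS]powRr1 ?(ltW e0) // -(mulVf (lt0r_neq0 p0)) powRrM.
by apply: ge0_ler_powR; rewrite ?nnegrE ?powR_ge0 // ltW.
Qed.

Variables (m : nat) (a : R).
Hypothesis a1 : 1 <= a.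

Lemma monomial_ge0 (x : m.-tuple R) : 0 <= monomial a x.
Proof. by apply: prodr_ge0 => i _; exact: powR_ge0. Qed.

Lemma monomial_le1 (x : m.-tuple R) : simplex x -> monomial a x <= 1.
Proof.
move=> [x01 _]; apply: (@le_trans _ _ (\prod_(i < m) 1)); last by rewrite big1.
apply: ler_prod => i _; rewrite powR_ge0 /=; have /andP[xi0 xi1] := x01 i.
rewrite -[leRHS](_ : 1 `^ (a - 1) = 1); last by rewrite powR1.
by apply: ge0_ler_powR; rewrite ?nnegrE ?subr_ge0.
Qed.

Lemma measurable_monomial : measurable_fun setT (monomial (m := m) a).
Proof.
apply: measurable_prod => i _.
exact: (measurableT_comp (measurable_powR (a - 1)) (measurable_tnth i)).
Qed.

Lemma seq_continuous_monomial : seq_continuous_on (@simplex R m) (monomial a).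
Proof.
move=> u x us xs ux; apply: cvg_big; first exact: mul_continuous.
move=> i _; apply: cvg_powR => //; first by rewrite subr_ge0.
  by move=> n; have [/(_ i) /andP[]] := us n.
by have [/(_ i) /andP[]] := xs.
Qed.

Lemma monomial_perm (x y : m.-tuple R) : perm_eq x y -> monomial a x = monomial a y.
Proof.
move=> xy; rewrite /monomial -!(big_tuple _ _ _ predT (fun z => z `^ (a - 1))).
exact: perm_big.
Qed.

End monomials.

(** * Integrability on the simplex and positivity of the normalizing constant *)

Section normalization.
Variables (R : realType) (m : nat).
Let mu := @lebesgue_tuple R m.
Let simplex' := @complete R m.+1 @^-1` @simplex R m.+1.
Let ordered' := @complete R m.+1 @^-1` @ordered_simplex R m.+1.

Lemma integrable_simplex_complete (F : m.+1.-tuple R -> R) (M : R) :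
  measurable_fun setT F -> (forall x, simplex x -> `|F x| <= M) ->
  mu.-integrable simplex' (fun t => (F (complete (m := m.+1) t))%:E).
Proof.
move=> mF FM; pose cube := [set t : m.-tuple R | forall i, tnth t i \in `[0, 0 + 1]].
have ms : measurable simplex' by exact: measurable_simplex_complete.
apply: measurable_bounded_integrable => //.
- apply: (@le_lt_trans _ _ (mu cube)).
    apply: le_measure; rewrite ?inE //; first exact: measurable_box.
    move=> t /simplex_completeP [t0 t1] i; rewrite in_itv /= t0 add0r.
    by apply: le_trans t1; rewrite (bigD1 i) //= lerDl; apply: sumr_ge0.
  by rewrite /cube /mu (@lebesgue_cube R m (fun=> 0) true false 1) ?ltry.
- apply: (@measurable_funS _ _ _ _ setT) => //.
  exact: (measurableT_comp mF (@measurable_complete R m)).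
- by exists M; split; [exact: num_real|move=> x /ltW Mx t /FM /le_trans; apply].
Qed.

Lemma measurable_ordered_complete : measurable ordered'.
Proof.
rewrite /ordered' -[X in measurable X]setTI; apply: measurable_complete => //.
have mt i : measurable_fun setT (@tnth m.+1 R ^~ i) by exact: measurable_tnth.
rewrite (_ : @ordered_simplex R m.+1 =
  (\bigcap_(i in [set: 'I_m.+1]) (@tnth _ R ^~ i) @^-1` `[0, 1]%classic)
  `&` (\bigcap_(i in [set: 'I_m.+1]) \bigcap_(j in [set j : 'I_m.+1 | (i < j)%N])
    (fun x : m.+1.-tuple R => tnth x i - tnth x j) @^-1` `]0, +oo[%classic)
  `&` (fun x : m.+1.-tuple R => \sum_(i < m.+1) tnth x i) @^-1` [set 1]).
  apply: measurableI; first apply: measurableI.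
  - apply: fin_bigcap_measurable => // i _; rewrite -[X in measurable X]setTI.
    exact: (mt i measurableT _ (measurable_itv _)).
  - apply: fin_bigcap_measurable => // i _; apply: fin_bigcap_measurable => // j _.
    rewrite -[X in measurable X]setTI.
    have mij : measurable_fun setT (fun x : m.+1.-tuple R => tnth x i - tnth x j).
      exact: measurable_funB.
    exact: (mij measurableT _ (measurable_itv _)).
  - rewrite -[X in measurable X]setTI.
    have ms : measurable_fun setT (fun x : m.+1.-tuple R => \sum_(i < m.+1) tnth x i).
      by apply: measurable_sum => i; exact: mt.
    exact: (ms measurableT _ (measurable_set1 1)).
apply/seteqP; split=> x.
  move=> [x01 xd x1]; split=> //; split=> i _; first by rewrite /= in_itv /=; exact: x01.
  by move=> j ij; rewrite /= in_itv /= andbT subr_gt0; exact: xd.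
move=> [[x01 xd] x1]; split=> // i; first by have := x01 i Logic.I; rewrite /= in_itv.
by move=> j ij; have := xd i Logic.I j ij; rewrite /= in_itv /= andbT subr_gt0.
Qed.

Lemma ordered_simplex_simplex : @ordered_simplex R m.+1 `<=` @simplex R m.+1.
Proof. by move=> x [x01 _ x1]; split. Qed.

(* The cube with lower corner proportional to (m + 1, m, ..., 2): its side is so
   small that the completed coordinates stay decreasing. *)
Lemma ordered_simplex_cube : exists (c : 'I_m -> R) (e : R), 0 < e /\
  forall t : m.-tuple R, (forall i, tnth t i \in `[c i, c i + e]) ->
    ordered' t /\ forall i, e <= tnth (complete (m := m.+1) t) i.
Proof.
pose S : R := \sum_(i < m.+1) (m.+1 - i)%:R.
have S0 : 0 < S.
  rewrite /S big_ord_recr /= subSnn; apply: ltr_wpDl => //; exact: sumr_ge0.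
(* With this choice [m.+2%:R * e = S^-1], so the corner [c] completes to a point whose last
   coordinate and successive gaps all equal [m.+2%:R * e]. Moving the first [m] coordinates up by at
   most [e] each shrinks the gaps between them by at most [e] and leaves at least [2 * e] for the
   last one. *)
pose e := (S * m.+2%:R)^-1.
have e0 : 0 < e by rewrite invr_gt0 mulr_gt0.
have Se : S * (m.+2%:R * e) = 1 by rewrite mulrA divff // gt_eqF // mulr_gt0.
pose c (i : 'I_m) : R := (m.+1 - i)%:R * (m.+2%:R * e).
exists c, e; split=> // t tc.
have ct i : c i <= tnth t i <= c i + e by have := tc i; rewrite in_itv.
have sumc : \sum_(i < m) c i = 1 - m.+2%:R * e.
  rewrite -[X in X - _]Se /S big_ord_recr /= subSnn mulrDl mul1r addrK mulr_suml.
  by apply: eq_bigr.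
set y := complete (m := m.+1) t.
have yw (i : 'I_m) : tnth y (widen_ord (leqnSn m) i) = tnth t i by exact: tnth_complete_widen.
have ym : e + e <= tnth y ord_max <= m.+2%:R * e.
  rewrite /y tnth_complete_max; apply/andP; split; last first.
    rewrite lerBlDr -lerBlDl -sumc; apply: ler_sum => i _.
    by case/andP: (ct i).
  rewrite lerBrDr -lerBrDl.
  apply: (@le_trans _ _ (\sum_(i < m) (c i + e))).
    by apply: ler_sum => i _; case/andP: (ct i).
  rewrite big_split /= sumc sumr_const card_ord -mulr_natl -!natr1; lra.
have N2 : 2 <= m.+2%:R :> R by rewrite ler_nat.
have ye i : e <= tnth y i.
  case: (ord_max_or_widen i) => [->|[j ->]]; first by case/andP: ym => + _; lra.
  rewrite yw; case/andP: (ct j) => + _; apply: le_trans.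
  have : 1 <= (m.+1 - j)%:R :> R by rewrite ler1n subn_gt0 ltnS ltnW.
  rewrite /c; nra.
have y0 i : 0 <= tnth y i by exact: le_trans (ltW e0) (ye i).
have y1 : \sum_(i < m.+1) tnth y i = 1 by exact: sum_complete.
split=> //; split=> [i|i j ij|//].
  by rewrite y0 -y1 (bigD1 i) //= lerDl; apply: sumr_ge0.
case: (ord_max_or_widen i) ij => [->|[k ->]] /=; first by rewrite ltnNge -ltnS ltn_ord.
case: (ord_max_or_widen j) => [->|[l ->]] /= kl; rewrite ?yw.
  case/andP: (ct k) => ck _; case/andP: ym => _ ym.
  have : 2 <= (m.+1 - k)%:R :> R by rewrite ler_nat; lia.
  by rewrite /c in ck; nra.
case/andP: (ct k) => ck _; case/andP: (ct l) => _ cl.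
have : (m.+1 - l)%:R + 1 <= (m.+1 - k)%:R :> R.
  by rewrite natr1 ler_nat; have := ltn_ord k; have := ltn_ord l; lia.
by rewrite /c in ck cl; nra.
Qed.

(** Finiteness of the integral counts as much as positivity, since [fine] turns an infinite value
    into 0. For the lower bound, on the cube of [ordered_simplex_cube] every completed coordinate is
    at least [e], so the monomial is at least [eta] there. *)
Lemma c0_gt0 (a : R) : 1 <= a -> 0 < c0 m.+1 a.
Proof.
move=> a1; rewrite /c0 invr_gt0.
have mono_int : mu.-integrable ordered' (fun t => (monomial a (complete (m := m.+1) t))%:E).
  apply: (integrableS (@measurable_simplex_complete R m) measurable_ordered_complete).
    by move=> t; exact: ordered_simplex_simplex.
  apply: (@integrable_simplex_complete _ 1); first exact: measurable_monomial.
  by move=> x xs; rewrite ger0_norm ?monomial_ge0 // monomial_le1.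
have [c [e [e0 ce]]] := ordered_simplex_cube.
pose cube := [set t : m.-tuple R | forall i, tnth t i \in `[c i, c i + e]].
have mcube : measurable cube by exact: measurable_box.
pose eta : R := \prod_(i < m.+1) e `^ (a - 1).
have eta0 : 0 < eta by apply: prodr_gt0 => i _; exact: powR_gt0.
rewrite fine_gt0 //; apply/andP; split; last first.
  by rewrite ltey_eq (integrable_fin_num measurable_ordered_complete mono_int).
apply: (@lt_le_trans _ _ (\int[mu]_(t in cube) (cst eta%:E t))%E).
  have cE : mu cube = (e ^+ m)%:E by apply: lebesgue_cube; exact: ltW.
  rewrite integral_cst // [X in (_ * X)%E]cE.
  by rewrite -EFinM lte_fin mulr_gt0 // exprn_gt0.
apply: (@le_trans _ _ (\int[mu]_(t in cube) (monomial a (complete (m := m.+1) t))%:E)%E).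
  apply: ge0_le_integral => //.
  - by move=> t _; rewrite lee_fin ltW.
  - apply/measurable_EFinP; apply: (@measurable_funS _ _ _ _ setT) => //.
    exact: (measurableT_comp (measurable_monomial a) (@measurable_complete R m)).
  - move=> t /ce [_ et]; rewrite lee_fin; apply: ler_prod => i _.
    rewrite powR_ge0 /=; apply: ge0_ler_powR; rewrite ?nnegrE ?subr_ge0 // ?(ltW e0) //.
    exact: le_trans (ltW e0) (et i).
apply: ge0_subset_integral => //.
- exact: measurable_ordered_complete.
- exact: measurable_int mono_int.
- by move=> t _; rewrite lee_fin monomial_ge0.
- by move=> t /ce [].
Qed.

End normalization.

(** * Sums over partitions *)

Section partition_sums.
Variables (R : realType).

Lemma values_map m n (c : m.-tuple 'I_n.+1) :
  values c = map (@nat_of_ord n.+1) c :> seq nat.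
Proof. by rewrite /= -[in RHS](map_tnth_enum c) -map_comp. Qed.

Lemma rescale_map m n (k : m.-tuple nat) :
  rescale R n k = [seq j%:R / n%:R | j <- k] :> seq R.
Proof. by rewrite /= -[in RHS](map_tnth_enum k) -map_comp. Qed.

Lemma perm_rescale_values m n (c c' : m.-tuple 'I_n.+1) : perm_eq c c' ->
  perm_eq (rescale R n (values c)) (rescale R n (values c')).
Proof. by move=> cc'; rewrite !rescale_map !values_map !perm_map. Qed.

Lemma rescale_simplex m n (k : m.-tuple nat) : (\sum_(i < m) tnth k i)%N = n.+1 ->
  @simplex R m (rescale R n.+1 k).
Proof.
move=> kn; have r0 i : 0 <= tnth (rescale R n.+1 k) i by rewrite tnth_mktuple divr_ge0.
have r1 : \sum_(i < m) tnth (rescale R n.+1 k) i = 1.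
  under eq_bigr do rewrite tnth_mktuple.
  by rewrite -mulr_suml -natr_sum kn divff // pnatr_eq0.
split=> // i; rewrite r0 -r1 (bigD1 i) //= lerDl; exact: sumr_ge0.
Qed.

Lemma sum_values m n (c : m.-tuple 'I_n.+1) :
  (c \in compositions m n) = ((\sum_(i < m) tnth (values c) i)%N == n).
Proof.
by rewrite inE big_tuple; congr (_ == _); apply: eq_bigr => i _; rewrite tnth_mktuple.
Qed.

Lemma order_stat_sorted m n (k : m.-tuple nat) : sorted geq k ->
  order_stat (rescale R n k) = rescale R n k.
Proof.
move=> ks; apply/val_inj; apply: sorted_sort.
  by move=> x y z /= xy zx; exact: le_trans zx xy.
rewrite rescale_map sorted_map; apply: sub_sorted ks => i j /= ji.
by rewrite ler_wpM2r ?invr_ge0 // ler_nat.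
Qed.

(** A duplicate-free list of the partitions, which turns the finitely supported sums into ordinary
    ones and serves as the list of values of a discrete variable. *)
Definition partition_seq m n : seq (m.-tuple nat) :=
  [seq values c | c <- enum (sorted_compositions m n)].

Lemma values_inj m n : injective (@values n m).
Proof.
move=> c c' cc'; apply: eq_from_tnth => i; apply/val_inj.
by have := congr1 (fun k => tnth k i) cc'; rewrite !tnth_mktuple.
Qed.

Lemma partition_seq_uniq m n : uniq (partition_seq m n).
Proof. by rewrite map_inj_uniq ?enum_uniq //; exact: values_inj. Qed.

Lemma partition_seqP m n : partitions n = [set` partition_seq m n].
Proof.
apply/seteqP; split=> k /=.
  move=> [ks kn].
  have kin i : (tnth k i < n.+1)%N by rewrite ltnS -kn (bigD1 i) //= leq_addr.
  pose c : m.-tuple 'I_n.+1 := [tuple Ordinal (kin i) | i < m].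
  have ck : values c = k by apply: eq_from_tnth => i; rewrite !tnth_mktuple.
  apply/mapP; exists c => //; rewrite mem_enum inE sum_values ck kn eqxx /=.
  have : sorted geq (values c) by rewrite ck.
  by rewrite values_map sorted_map.
case/mapP=> c; rewrite mem_enum inE sum_values => /andP[/eqP cn cs] ->; split=> //.
by rewrite values_map sorted_map.
Qed.

Lemma cvg_partition_sum k (F : k.+2.-tuple R -> R) (M : R) :
  measurable_fun setT F -> (forall x, @simplex R k.+2 x -> `|F x| <= M) ->
  (forall x y : k.+2.-tuple R, perm_eq x y -> F x = F y) ->
  seq_continuous_on (@simplex R k.+2) F ->
  (\sum_(p <- partition_seq k.+2 n.+1) F (rescale R n.+1 p)) / n.+1%:R ^+ k.+1
  @[n --> \oo] -->
  fine (\int[@lebesgue_tuple R k.+1]_(t in @complete R k.+2 @^-1` @simplex R k.+2)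
    (F (complete (m := k.+2) t))%:E) / (k.+2)`!%:R.
Proof.
move=> mF FM Fsym Fc.
pose I := fine (\int[@lebesgue_tuple R k.+1]_(t in @complete R k.+2 @^-1` @simplex R k.+2)
    (F (complete (m := k.+2) t))%:E).
pose S n := \sum_(p <- partition_seq k.+2 n.+1) F (rescale R n.+1 p).
pose C n := \sum_(c in compositions k.+2 n.+1) F (rescale R n.+1 (values c)).
have lC : C n / n.+1%:R ^+ k.+1 @[n --> \oo] --> I.
  have Ifin := integrable_fin_num (@measurable_simplex_complete R k.+1)
    (integrable_simplex_complete mF FM).
  by have := cvg_riemann_sum mF FM Fc; rewrite -(fineK Ifin) => /fine_cvg.
have fact0 : (k.+2)`!%:R != 0 :> R by rewrite pnatr_eq0 -lt0n fact_gt0.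
suff lS : S n *+ (k.+2)`! / n.+1%:R ^+ k.+1 @[n --> \oo] --> I.
  rewrite [X in X @ _](_ : _ = fun n => (S n *+ (k.+2)`! / n.+1%:R ^+ k.+1) / (k.+2)`!%:R).
    by apply: cvgM => //; exact: cvg_cst.
  by apply/funext => n; rewrite -/(S n) -[S n *+ _]mulr_natr [RHS]mulrAC mulfK.
have M0 : 0 <= M.
  apply: le_trans (FM (complete (m := k.+2) [tuple 0 | i < k.+1]) _) => //.
  apply/simplex_completeP; split=> [i|]; first by rewrite tnth_mktuple.
  by rewrite big1 // => i _; rewrite tnth_mktuple.
(* The factor [2 ^ k] comes from [n.+2 ^ k <= (2 * n.+1) ^ k]: the tie bound at [n.+1] involves
   [n.+2], the normalization [n.+1]. *)
pose B : R := M * ((k.+2)`!.+1 * (k.+2 ^ 2 * 2 ^ k))%:R.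
rewrite (_ : (fun n => _) = (fun n => C n / n.+1%:R ^+ k.+1 +
    (S n *+ (k.+2)`! - C n) / n.+1%:R ^+ k.+1)); last first.
  by apply/funext => n; rewrite -mulrDl subrKC.
rewrite -[X in _ --> X]addr0; apply: cvgD => //; apply: norm_cvg0.
apply: (@squeeze_cvgr _ _ _ _ (cst 0) (fun n => B * harmonic n)); last 2 first.
- exact: cvg_cst.
- by rewrite -[X in _ --> X](mulr0 B); apply: cvgM; [exact: cvg_cst|exact: cvg_harmonic].
apply: nearW => n; rewrite normr_ge0 /= normrM normfV [`|_ ^+ _|]ger0_norm ?exprn_ge0 //.
have n0 : 0 < n.+1%:R :> R by rewrite ltr0n.
rewrite ler_pdivrMr ?exprn_gt0 // exprS mulrA -[B * _ * _]mulrA mulVf ?gt_eqF // mulr1.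
have -> : S n = \sum_(c in sorted_compositions k.+2 n.+1) F (rescale R n.+1 (values c)).
  by rewrite /S big_map big_enum.
apply: le_trans (le_dist_sum_compositions M0 _ _) _.
- move=> c; rewrite sum_values => /eqP cn; apply: FM; exact: rescale_simplex.
- by move=> c c' cc'; apply: Fsym; exact: perm_rescale_values.
rewrite /B -[leLHS]mulr_natr -mulrA ler_wpM2l // -natrX -natrM ler_nat -!mulnA.
rewrite 3?leq_mul // !subSS subn0 -expnMn.
case: (posnP k) => [->|k0]; first by rewrite !expn0.
by rewrite leq_exp2r // mul2n -addnn addSn !addnS ltnS leq_addr.
Qed.

End partition_sums.

(** * Convergence in distribution *)

(** Since the weights over [s] add up to 1, [K] lies in [s] almost surely, and the rest of the space
    is negligible for the integral. *)
Lemma expectation_pmf_finite d (T : measurableType d) (R : realType) (Q : probability T R)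
    m (K : {RV Q >-> m.-tuple nat}) (s : seq (m.-tuple nat)) (w : m.-tuple nat -> R)
    (phi : m.-tuple nat -> R) (M : R) :
  uniq s -> (forall k, k \in s -> distribution Q K [set k] = (w k)%:E) ->
  \sum_(k <- s) w k = 1 -> (forall k, `|phi k| <= M) ->
  ('E_Q[fun x => phi (K x)] = (\sum_(k <- s) phi k * w k)%:E)%E.
Proof.
move=> Us Qw w1 phiM.
have mK (A : set (m.-tuple nat)) : measurable (K @^-1` A).
  rewrite -[X in measurable X]setTI.
  exact: (measurable_funPT K measurableT _ (measurable_tuple_nat A)).
have intA (psi : m.-tuple nat -> R) :
    (\int[Q]_(x in K @^-1` [set` s]) (psi (K x))%:E = (\sum_(k <- s) psi k * w k)%:E)%E.
  transitivity (\int[Q]_(x in K @^-1` [set` s]) (psi (K x) * 1)%:E)%E.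
    by apply: eq_integral => x _; rewrite mulr1.
  rewrite (@integral_finite_fibers _ _ _ Q _ _ K s psi (cst 1)) //; last 2 first.
  - by move=> k; apply: measurableI; exact: mK.
  - exact: finite_measure_integrable_cst.
  rewrite -sumEFin; apply: eq_big_seq => k ks.
  rewrite (_ : _ `&` _ = K @^-1` [set k]); last first.
    by apply/setIidPr => x /= ->.
  by rewrite /cst integral_cst ?mul1e ?EFinM -?Qw.
(* The probability is the integral of the constant 1, a case of [intA]. *)
have QA : Q (K @^-1` [set` s]) = 1%E.
  rewrite -[LHS]mul1e -(integral_cst Q (mK _)) (intA (cst 1)).
  by rewrite (eq_bigr w) ?w1 // => k _; rewrite mul1r.
have mphi : measurable_fun setT (fun x => phi (K x)).
  exact: (measurableT_comp (measurable_fun_tuple_nat phi) (measurable_funPT K)).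
rewrite unlock (@negligible_integral _ _ _ Q _ (~` (K @^-1` [set` s]))) //.
- by rewrite setTD setCK intA.
- by apply: measurableC; exact: mK.
- apply: (measurable_bounded_integrable (f := fun x => phi (K x))) => //.
    by rewrite (le_lt_trans (probability_le1 _ _)) ?ltry.
  by exists M; split; [exact: num_real|move=> x /ltW Mx t _; exact: le_trans Mx].
- by apply: etrans (probability_setC Q (mK _)) _; rewrite QA subee.
Qed.

Section dirichlet_expectation.
Context d (T : measurableType d) (R : realType) (m : nat) (P : probability T R).
Variables (X : {RV P >-> m.+1.-tuple R}) (a : R).
Hypotheses (a1 : 1 <= a) (hX : dirichlet P X a).
Let mu := @lebesgue_tuple R m.
Let simplex' := @complete R m.+1 @^-1` @simplex R m.+1.
Let const : R := gamma_fun (m.+1%:R * a) / gamma_fun a ^+ m.+1.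

(** An instance of [integral_change_density] with [Z] the completion map; the density vanishes off
    the simplex, which restricts the domain. *)
Lemma expectation_dirichlet (G : m.+1.-tuple R -> R) (M : R) :
  measurable_fun setT G -> (forall x, `|G x| <= M) ->
  ('E_P[fun w => G (X w)] = const%:E *
    \int[mu]_(t in simplex')
      (G (complete (m := m.+1) t) * monomial a (complete (m := m.+1) t))%:E)%E.
Proof.
move=> mG GM; have M0 : 0 <= M by apply: le_trans (GM [tuple 0 | i < m.+1]).
have ms : measurable simplex' by exact: measurable_simplex_complete.
pose p (t : m.-tuple R) : R := dirichlet_pdf a (complete (m := m.+1) t).
have pE (t : m.-tuple R) (G' : m.+1.-tuple R -> R) :
    (G' (complete (m := m.+1) t) * p t)%:E =
  ((fun t => (const * (G' (complete (m := m.+1) t) *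
    monomial a (complete (m := m.+1) t)))%:E) \_ simplex') t.
  rewrite patchE /p /dirichlet_pdf.
  have -> : (t \in simplex') = (complete (m := m.+1) t \in @simplex R m.+1).
    by apply/idP/idP; rewrite !inE.
  by case: ifP => _; rewrite ?mulr0 // mulrCA.
(* The bound [M + 1] covers both uses: [G] itself and the constant 1. *)
have imono (G' : m.+1.-tuple R -> R) : measurable_fun setT G' ->
    (forall x, `|G' x| <= M + 1) -> mu.-integrable simplex' (fun t =>
      (G' (complete (m := m.+1) t) * monomial a (complete (m := m.+1) t))%:E).
  move=> mG' GM'.
  apply: (@integrable_simplex_complete _ _ (fun x => G' x * monomial a x) (M + 1)).
    by apply: measurable_funM => //; exact: measurable_monomial.
  move=> x xs; rewrite normrM -[leRHS]mulr1 ler_pM // ger0_norm ?monomial_ge0 //.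
  exact: monomial_le1.
have ip : mu.-integrable setT (EFin \o p).
  rewrite (_ : EFin \o p = (fun t =>
    (const * (1 * monomial a (complete (m := m.+1) t)))%:E) \_ simplex'); last first.
    by apply/funext => t; rewrite -(pE t (cst 1)) mul1r.
  rewrite -integrable_restrict // setTI.
  by apply: (integrableZl ms const (imono (cst 1) _ _)) => // x; rewrite normr1 lerDr.
rewrite unlock.
rewrite (@integral_change_density _ _ _ _ _ _ _ P mu X (@complete R m.+1) p _ _ ip _ G M) //.
- under eq_integral do rewrite pE.
  rewrite -integral_mkcond.
  rewrite -integralZl //; apply: (imono G) => // x.
  by apply: le_trans (GM x) _; rewrite lerDl.
- exact: measurable_complete.
Qed.

End dirichlet_expectation.

Theorem corollary2 (R : realType) (m : nat) (hm : (2 <= m)%N)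
  (alpha : R) (halpha : 1 <= alpha)
  (d : nat -> measure_display) (T : forall n : nat, measurableType (d n))
  (Q : forall n : nat, probability (T n) R)
  (K : forall n : nat, {RV (Q n) >-> m.-tuple nat})
  (hK : forall n : nat, (0 < n)%N -> 0 < norm_sum m alpha n ->
    forall k : m.-tuple nat, partitions n k ->
      distribution (Q n) (K n) [set k] = (Pn alpha n k)%:E)
  (d' : measure_display) (T' : measurableType d') (P : probability T' R)
  (X : {RV P >-> m.-tuple R}) (hX : dirichlet P X alpha) :
  cvg_in_distribution Q (fun n w => rescale R n (K n w))
    P (fun w => order_stat (X w)).
Proof.
case: m hm K hK X hX => [//|[//|k]] _ K hK X hX g gc [M gM].
pose m := k.+2; pose mu := @lebesgue_tuple R k.+1.
pose G (x : m.-tuple R) : R := g (\row_i tnth (order_stat x) i).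
pose W (F : m.-tuple R -> R) :=
  (\int[mu]_(t in @complete R m @^-1` @simplex R m) (F (complete (m := m) t))%:E)%E.
pose S (F : m.-tuple R -> R) n := \sum_(p <- partition_seq m n.+1) F (rescale R n.+1 p).
pose mono : m.-tuple R -> R := monomial alpha.
pose gmono (x : m.-tuple R) : R := G x * mono x.
pose const : R := gamma_fun (m%:R * alpha) / gamma_fun alpha ^+ m.
have mono0 x : 0 <= mono x by exact: monomial_ge0.
have GM x : `|G x| <= M by exact: gM.
have Gc : seq_continuous_on setT G by exact: seq_continuous_order_stat.
have mG : measurable_fun setT G by exact: measurable_seq_continuous.
have mmono : measurable_fun setT mono by exact: measurable_monomial.
have monoM x : @simplex R m x -> `|mono x| <= 1.
  by move=> xs; rewrite ger0_norm // monomial_le1.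
have mgmono : measurable_fun setT gmono by exact: measurable_funM.
have gmonoM x : @simplex R m x -> `|gmono x| <= M.
  by move=> xs; rewrite normrM -[leRHS]mulr1 ler_pM // monoM.
have finW (F : m.-tuple R -> R) (B : R) : measurable_fun setT F ->
    (forall x, @simplex R m x -> `|F x| <= B) ->
    W F \is a fin_num.
  move=> mF FB; apply: integrable_fin_num; first exact: measurable_simplex_complete.
  exact: (integrable_simplex_complete mF FB).
have EG : ('E_P[fun w => G (X w)] = (const * fine (W gmono))%:E)%E.
  by rewrite (expectation_dirichlet halpha hX mG GM) [RHS]EFinM (fineK (finW _ _ mgmono gmonoM)).
(* The expectation of the constant 1 determines the Gamma factor, so the Gamma integrals are never
   computed. It also shows that [W mono] is nonzero. *)
have E1 : const * fine (W mono) = 1.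
  apply: EFin_inj; rewrite [LHS]EFinM (fineK (finW _ _ mmono monoM)).
  have := @expectation_dirichlet _ _ _ _ _ _ _ halpha hX (cst 1) 1.
  rewrite expectation_cst => -> //; last by move=> x; rewrite normr1.
  by congr (_ * _)%E; apply: eq_integral => t _; rewrite mul1r.
have W0 : 0 < fine (W mono).
  rewrite lt_neqAle fine_ge0; last by apply: integral_ge0 => t _; rewrite lee_fin.
  by rewrite andbT eq_sym; apply: contra_eq_neq E1 => ->; rewrite mulr0 eq_sym oner_neq0.
have fact0 : 0 < m`!%:R :> R by rewrite ltr0n fact_gt0.
have Smono : S mono n / n.+1%:R ^+ k.+1 @[n --> \oo] --> fine (W mono) / m`!%:R.
  apply: cvg_partition_sum mmono monoM _ _; first exact: monomial_perm.
  exact: seq_continuous_monomial.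
have Sgmono : S gmono n / n.+1%:R ^+ k.+1 @[n --> \oo] --> fine (W gmono) / m`!%:R.
  apply: cvg_partition_sum mgmono gmonoM _ _.
    move=> x y xy; rewrite /gmono /mono /G (order_stat_perm xy).
    by rewrite (monomial_perm alpha xy).
  move=> u x us xs ux; apply: cvgM; first exact: Gc.
  exact: (seq_continuous_monomial halpha).
have c0pos := @c0_gt0 R k.+1 alpha halpha.
have normE n : norm_sum m alpha n.+1 = c0 m alpha * S mono n.
  rewrite /norm_sum partition_seqP -fsbig_seq ?partition_seq_uniq // mulr_sumr.
  by [].
(* [c0] cancels between the density and the normalizing sum. Partitions are already sorted, so [g]
   and [G] agree on them. *)
have E_eq n : 0 < S mono n ->
    ('E_(Q n.+1)[fun w => g (\row_i tnth (rescale R n.+1 (K n.+1 w)) i)] =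
    (S gmono n / S mono n)%:E)%E.
  move=> S0; have N0 : 0 < norm_sum m alpha n.+1 by rewrite normE mulr_gt0.
  have cc : c0 m alpha != 0 by rewrite gt_eqF.
  have PnE p : Pn alpha n.+1 p = mono (rescale R n.+1 p) / S mono n.
    by rewrite /Pn normE /simplex_density -/mono; field; rewrite cc gt_eqF.
  rewrite (@expectation_pmf_finite _ _ _ _ _ (K n.+1) (partition_seq m n.+1) (Pn alpha n.+1)
    (fun p => g (\row_i tnth (rescale R n.+1 p) i)) M) ?partition_seq_uniq //.
  - congr EFin; rewrite /S mulr_suml; apply: eq_big_seq => p pn.
    rewrite PnE /gmono mulrA /G order_stat_sorted //.
    have : partitions n.+1 p by rewrite partition_seqP.
    by case.
  - by move=> p pn; apply: hK => //; rewrite partition_seqP.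
  - under eq_bigr do rewrite PnE.
    by rewrite -mulr_suml divff // gt_eqF.
pose u n := 'E_(Q n)[fun w => g (\row_i tnth (rescale R n (K n w)) i)]%E.
(* Shifting the index leaves the limit unchanged and discards [n = 0], where [hK] says nothing and
   [rescale] divides by 0. *)
suff lim1 : u n.+1 @[n --> \oo] --> 'E_P[fun w => G (X w)]%E.
  by move: lim1; rewrite (cvg_shiftS u).
(* The scaled sums have a positive limit, so the normalizing sum is eventually positive and [hK]
   becomes available. *)
have Spos : \forall n \near \oo, 0 < S mono n.
  have : \forall n \near \oo, 0 < S mono n / n.+1%:R ^+ k.+1.
    by apply: (cvgr_gt _ Smono); rewrite divr_gt0.
  by apply: filterS => n; rewrite pmulr_lgt0 // invr_gt0 exprn_gt0.
have lim : (S gmono n / n.+1%:R ^+ k.+1) / (S mono n / n.+1%:R ^+ k.+1) @[n --> \oo] -->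
    (fine (W gmono) / m`!%:R) / (fine (W mono) / m`!%:R).
  apply: cvgM => //; apply: cvgV => //.
  by rewrite gt_eqF // divr_gt0.
rewrite EG (_ : const * _ = (fine (W gmono) / m`!%:R) / (fine (W mono) / m`!%:R)); last first.
  have -> : const = (fine (W mono))^-1 by rewrite -[LHS](mulfK (lt0r_neq0 W0)) E1 mul1r.
  by field; rewrite !gt_eqF.
have limE : ((S gmono n / n.+1%:R ^+ k.+1) / (S mono n / n.+1%:R ^+ k.+1))%:E
    @[n --> \oo] --> ((fine (W gmono) / m`!%:R) / (fine (W mono) / m`!%:R))%:E.
  by apply: cvg_EFin lim; exact: nearW.
apply: cvg_trans limE; apply: near_eq_cvg; apply: filterS Spos => n S0.
rewrite /u E_eq //; congr EFin.
by field; rewrite expf_neq0 ?pnatr_eq0 //= gt_eqF.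
Qed.
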